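(* Let $g$ be a Lorentzian metric, and let $\gamma$ be a null geodesic of $g$. Let $g_\sigma:=e^{\sigma}g$, with $\sigma$ a smooth function, be a conformal change of $g$ (up to reparametrization, $\gamma$ is also a null geodesic of $g_\sigma$). Let $\mathrm{PL}_g$ (resp. $\mathrm{PL}_{g_\sigma}$) denote the Penrose limit of $g$ (resp. of $g_\sigma$) along $\gamma$. Then there exists a conformal diffeomorphism $\mathrm{PL}_g\to\mathrm{PL}_{g_\sigma}$.
   Context: Penrose limit: let $\gamma$ be a null geodesic of a Lorentzian metric $g$. There are local coordinates $(u,v,x)$, $x=(x_1,\dots,x_n)$, adapted to $\gamma$, i.e. such that $\gamma$ is $u\mapsto(u,0,0)$ with $u$ an affine parameter, and $$g=2\,du\,dv+a(u,v,x)\,dv^2+\sum_i 2b_i(u,v,x)\,dv\,dx_i+\sum_{i,j}c_{ij}(u,v,x)\,dx_i\,dx_j .$$ For $\epsilon>0$ put $\Phi_\epsilon(u,v,x)=(u,\epsilon^2v,\epsilon x)$ and $g_\epsilon=\epsilon^{-2}\Phi_\epsilon^*g$. The Penrose limit of $g$ along $\gamma$ is the limit of $g_\epsilon$ as $\epsilon\to0$, namely the metric $$\mathrm{PL}_g=2\,du\,dv+\sum_{i,j}c_{ij}(u,0,0)\,dx_i\,dx_j ,$$ where $u$ ranges over the parameter interval of the considered piece of $\gamma$, and $v\in\mathbb R$, $x\in\mathbb R^n$. The Penrose limit of $g_\sigma$ along $\gamma$ is formed in the same way, using coordinates adapted to $\gamma$ (affinely reparametrized for $g_\sigma$) for the metric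 $g_\sigma$, over the same piece of $\gamma$. *)

(* Defs.v *)
From HB Require Import structures.
From mathcomp Require Import all_boot all_order all_algebra.
From mathcomp Require Import all_classical all_reals all_analysis.

Set Implicit Arguments.
Unset Strict Implicit.
Unset Printing Implicit Defensive.

Import Order.TTheory GRing.Theory Num.Theory.
Import numFieldNormedType.Exports.

Local Open Scope classical_set_scope.
Local Open Scope ring_scope.

(* Meant for open sets U: being C^(k+1) on U is having all directional
   derivatives on U, each of them C^k. Nothing is required of f outside U. *)
Fixpoint Ck_on {R : realType} {V W : normedModType R} (k : nat)
    (U : set V) (f : V -> W) : Prop :=
  (forall p, U p -> {for p, continuous f}) /\
  match k with
  | 0%N => True
  | k'.+1 => forall v : V,
      (forall p, U p -> derivable f p v) /\ Ck_on k' U (fun p => 'D_v f p)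
  end.

Definition smooth_on {R : realType} {V W : normedModType R}
    (U : set V) (f : V -> W) : Prop :=
  forall k, Ck_on k U f.

Definition open_interval {R : realType} (J : set R) : Prop :=
  [/\ open J, is_interval J & J !=set0].

(* [chart_inv] is irrelevant outside [chart_map @` chart_dom]. *)
Record chart (R : realType) (m : nat) (M : topologicalType) := Chart {
  chart_dom : set M;
  chart_map : M -> 'rV[R]_m;
  chart_inv : 'rV[R]_m -> M;
  chart_dom_open : open chart_dom;
  chart_codom_open : open (chart_map @` chart_dom);
  chart_mapK : forall x, chart_dom x -> chart_inv (chart_map x) = x;
  chart_map_continuous : forall x, chart_dom x -> {for x, continuous chart_map};
  chart_inv_continuous :
    forall p, (chart_map @` chart_dom) p -> {for p, continuous chart_inv}
}.

Definition chart_codom {R : realType} {m : nat} {M : topologicalType}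
    (phi : chart R m M) : set 'rV[R]_m :=
  chart_map phi @` chart_dom phi.

Definition transition {R : realType} {m : nat} {M : topologicalType}
    (phi psi : chart R m M) : 'rV[R]_m -> 'rV[R]_m :=
  chart_map psi \o chart_inv phi.

Definition overlap {R : realType} {m : nat} {M : topologicalType}
    (phi psi : chart R m M) : set 'rV[R]_m :=
  chart_map phi @` (chart_dom phi `&` chart_dom psi).

Definition compatible {R : realType} {m : nat} {M : topologicalType}
    (phi psi : chart R m M) : Prop :=
  smooth_on (overlap phi psi) (transition phi psi) /\
  smooth_on (overlap psi phi) (transition psi phi).

Record manifold (R : realType) (m : nat) := Manifold {
  carrier :> topologicalType;
  atlas : set (chart R m carrier);
  carrier_hausdorff : hausdorff_space carrier;
  carrier_second_countable : @second_countable carrier;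
  atlas_cover : forall x : carrier, exists2 phi, atlas phi & chart_dom phi x;
  atlas_compatible :
    forall phi psi, atlas phi -> atlas psi -> compatible phi psi;
  atlas_maximal :
    forall phi, (forall psi, atlas psi -> compatible phi psi) -> atlas phi
}.

Definition smooth_function {R : realType} {m : nat} (M : manifold R m)
    (f : M -> R) : Prop :=
  forall phi : chart R m M, atlas phi ->
    smooth_on (chart_codom phi) (f \o chart_inv phi).

(* Tangent vectors are row vectors, a metric with matrix G has value
   v *m G *m w^T on (v, w), and the differential of F at p is
   v |-> v *m jacobian F p. *)
Definition pullback {R : realType} {m : nat} (F : 'rV[R]_m -> 'rV[R]_m)
    (G : 'rV[R]_m -> 'M[R]_m) (p : 'rV[R]_m) : 'M[R]_m :=
  jacobian F p *m G (F p) *m (jacobian F p)^T.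

(* Signature (-, +, ..., +). *)
Definition minkowski {R : realType} {m : nat} : 'M[R]_m :=
  diag_mx (\row_i (if val i == 0%N then -1 else 1)).

Definition lorentzian_mx {R : realType} {m : nat} (A : 'M[R]_m) : Prop :=
  exists2 P : 'M[R]_m, P \in unitmx & P *m A *m P^T = minkowski.

(* A tensor field of type (0,2), given by its matrix in every chart; values at
   charts outside the atlas, or off [chart_codom phi], are irrelevant. *)
Definition metric_family {R : realType} {m : nat} (M : manifold R m) :=
  chart R m M -> 'rV[R]_m -> 'M[R]_m.

Definition lorentzian_metric {R : realType} {m : nat} (M : manifold R m)
    (g : metric_family M) : Prop :=
  [/\ forall phi, atlas phi -> smooth_on (chart_codom phi) (g phi),
      forall phi p, atlas phi -> chart_codom phi p ->
        (g phi p)^T = g phi p /\ lorentzian_mx (g phi p)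
    & forall phi psi p, atlas phi -> atlas psi ->
        overlap phi psi p ->
        g phi p = pullback (transition phi psi) (g psi) p].

Definition conformal_change {R : realType} {m : nat} (M : manifold R m)
    (sigma : M -> R) (g : metric_family M) : metric_family M :=
  fun phi p => expR (sigma (chart_inv phi p)) *: g phi p.

Definition partial {R : realType} {m : nat} (i : 'I_m)
    (f : 'rV[R]_m -> R) (p : 'rV[R]_m) : R :=
  'D_(delta_mx 0 i) f p.

Definition christoffel {R : realType} {m : nat} (G : 'rV[R]_m -> 'M[R]_m)
    (k i j : 'I_m) (p : 'rV[R]_m) : R :=
  2^-1 * \sum_l invmx (G p) k l *
    (partial i (fun q => G q j l) p + partial j (fun q => G q i l) p
     - partial l (fun q => G q i j) p).

Definition geodesic_eq {R : realType} {m : nat} (G : 'rV[R]_m -> 'M[R]_m)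
    (y : R -> 'rV[R]_m) (s : R) : Prop :=
  forall k, derive1n 2 y s 0 k +
    \sum_i \sum_j christoffel G k i j (y s) * derive1 y s 0 i * derive1 y s 0 j = 0.

(* The geodesic equation (in every chart) says that s is an affine
   parameter. *)
Definition null_geodesic {R : realType} {m : nat} (M : manifold R m)
    (g : metric_family M) (I : set R) (gamma : R -> M) : Prop :=
  (forall s, I s -> {for s, continuous gamma}) /\
  forall phi : chart R m M, atlas phi ->
    let D := I `&` gamma @^-1` chart_dom phi in
    let y := chart_map phi \o gamma in
    smooth_on D y /\
    forall s, D s ->
      [/\ geodesic_eq (g phi) y s,
          derive1 y s != 0
        & derive1 y s *m g phi (y s) *m (derive1 y s)^T = 0].

(* gamma' on J' is gamma on J, reparametrized by the diffeomorphism h. *)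
Definition reparametrization {R : realType} {T : Type}
    (J : set R) (gamma : R -> T) (J' : set R) (gamma' : R -> T) : Prop :=
  exists h : R -> R,
    [/\ smooth_on J h, forall s, J s -> derive1 h s != 0, h @` J = J'
      & forall s, J s -> gamma' (h s) = gamma s].

(* Positions of the coordinates (u, v, x_1, ..., x_n) in 'rV_(n.+2). *)
Definition iu {n : nat} : 'I_n.+2 := ord0.
Definition iv {n : nat} : 'I_n.+2 := lift ord0 ord0.
Definition ix {n : nat} (i : 'I_n) : 'I_n.+2 := lift ord0 (lift ord0 i).

Definition axis {R : realType} {n : nat} (u : R) : 'rV[R]_n.+2 :=
  u *: delta_mx 0 iu.

(* For symmetric A: A = 2 du dv + a dv^2 + 2 b_i dv dx_i + c_ij dx_i dx_j with
   a = A iv iv, b_i = A iv (ix i) and c_ij = A (ix i) (ix j). *)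
Definition adapted_form {R : realType} {n : nat} (A : 'M[R]_n.+2) : Prop :=
  [/\ A iu iu = 0, A iu iv = 1 & forall i, A iu (ix i) = 0].

Definition adapted_chart {R : realType} {n : nat} (M : manifold R n.+2)
    (g : metric_family M) (J : set R) (gamma : R -> M)
    (phi : chart R n.+2 M) : Prop :=
  [/\ atlas phi,
      forall u, J u -> chart_dom phi (gamma u) /\ chart_map phi (gamma u) = axis u
    & forall p, chart_codom phi p -> adapted_form (g phi p)].

Definition dilation_weight {R : realType} {n : nat} (e : R)
    (i : 'I_n.+2) : R :=
  if i == iu then 1 else if i == iv then e ^+ 2 else e.

Definition dilation {R : realType} {n : nat} (e : R)
    (p : 'rV[R]_n.+2) : 'rV[R]_n.+2 :=
  \row_i (dilation_weight e i * p 0 i).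

Definition rescaled {R : realType} {n : nat} (G : 'rV[R]_n.+2 -> 'M[R]_n.+2)
    (e : R) (p : 'rV[R]_n.+2) : 'M[R]_n.+2 :=
  e ^- 2 *: pullback (dilation e) G p.

(* To be applied to the matrix of a metric in an adapted chart, and used on
   [penrose_domain J]; see [cvg_rescaled] and [penrose_limitE]. *)
Definition penrose_limit {R : realType} {n : nat}
    (G : 'rV[R]_n.+2 -> 'M[R]_n.+2) (p : 'rV[R]_n.+2) : 'M[R]_n.+2 :=
  lim (rescaled G e p @[e --> 0^'+]).

Definition penrose_domain {R : realType} {n : nat} (J : set R) :
    set 'rV[R]_n.+2 :=
  [set p | J (p 0 iu)].

(* 2 du dv + c_ij(u,0,0) dx_i dx_j *)
Definition rosen_mx {R : realType} {n : nat}
    (G : 'rV[R]_n.+2 -> 'M[R]_n.+2) (p : 'rV[R]_n.+2) : 'M[R]_n.+2 :=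
  \matrix_(i, j)
    if (i == iu) || (j == iu) then (((i == iv) || (j == iv))%:R : R)
    else if (i == iv) || (j == iv) then 0
    else G (axis (p 0 iu)) i j.

Definition conformal_diffeomorphism {R : realType} {m : nat}
    (D1 : set 'rV[R]_m) (G1 : 'rV[R]_m -> 'M[R]_m)
    (D2 : set 'rV[R]_m) (G2 : 'rV[R]_m -> 'M[R]_m)
    (F : 'rV[R]_m -> 'rV[R]_m) : Prop :=
  (exists F' : 'rV[R]_m -> 'rV[R]_m,
     [/\ smooth_on D1 F, smooth_on D2 F',
         forall p, D1 p -> D2 (F p) /\ F' (F p) = p
       & forall q, D2 q -> D1 (F' q) /\ F (F' q) = q]) /\
  (exists lambda : 'rV[R]_m -> R,
     smooth_on D1 lambda /\
     forall p, D1 p ->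
       0 < lambda p /\ pullback F G2 p = lambda p *: G1 p).

Section PenroseLimitFormula.
Context {R : realType} {n : nat}.
Implicit Types (p : 'rV[R]_n.+2) (G : 'rV[R]_n.+2 -> 'M[R]_n.+2).

Lemma cvg_mx_entries (T : Type) (F : set_system T) (a b : nat)
    (f : T -> 'M[R]_(a, b)) (l : 'M[R]_(a, b)) : Filter F ->
  (forall i j, f x i j @[x --> F] --> l i j) -> f x @[x --> F] --> l.
Proof.
move=> FF fl; apply/cvg_ballP => r r0.
have : \forall x \near F, forall i j, ball (l i j) r (f x i j).
  apply: filter_forall => i; apply: filter_forall => j.
  by move/cvg_ballP : (fl i j); exact.
by apply: filterS => x Hx; split.
Qed.

Lemma cvg_mul0 (T : Type) (F : set_system T) (f f' : T -> R) (l : R) :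
  Filter F -> f x @[x --> F] --> 0 -> f' x @[x --> F] --> l ->
  f x * f' x @[x --> F] --> 0.
Proof.
move=> FF f0 fl; have : f x * f' x @[x --> F] --> 0 * l by exact: cvgM.
by rewrite mul0r.
Qed.

Lemma dilationE (e : R) p :
  dilation e p = p *m diag_mx (\row_i dilation_weight e i).
Proof.
by apply/rowP => i; rewrite mxE mul_mx_diag !mxE mulrC.
Qed.

Lemma jacobian_dilation (e : R) p :
  jacobian (dilation e) p = diag_mx (\row_i dilation_weight e i).
Proof.
have dE : dilation e = mulmxr (diag_mx (\row_i dilation_weight e i))
    :> ('rV[R]_n.+2 -> _).
  by apply/funext => q; rewrite dilationE.
rewrite dE /jacobian diff_lin; last first.
  move=> q; apply: (@cvg_mx_entries _ (nbhs q) _ _ _ _ (nbhs_filter q)) => i j.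
  rewrite /= mul_mx_diag mxE.
  under eq_fun do rewrite mul_mx_diag mxE.
  apply: cvgM; last exact: cvg_cst.
  exact: coord_continuous.
by apply/row_matrixP => i; rewrite !rowE mul_rV_lin1.
Qed.

Lemma rescaledE G (e : R) p i j : rescaled G e p i j =
  e ^- 2 * (dilation_weight e i * dilation_weight e j * G (dilation e p) i j).
Proof.
rewrite /rescaled /pullback jacobian_dilation tr_diag_mx mul_mx_diag mul_diag_mx.
by rewrite !mxE mulrAC.
Qed.

Lemma cvg_dilation p : dilation e p @[e --> 0^'+] --> 
  (axis (p 0 iu) : 'rV[R]_n.+2).
Proof.
apply: cvg_mx_entries => i j; rewrite !mxE ord1 eqxx /=.
under eq_fun do rewrite mxE /dilation_weight.
have e0 : e @[e --> (0:R)^'+] --> (0 : R) by exact: cvg_at_right_filter.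
case: (eqVneq j iu) => [->|ju].
  by rewrite mulr1; under eq_fun do rewrite mul1r; exact: cvg_cst.
have w0 : (if j == iv then e ^+ 2 else e) @[e --> (0:R)^'+] --> (0 : R).
  case: (j == iv) => //=.
  under eq_fun do rewrite expr2.
  exact: (@cvg_mul0 R 0^'+ id id 0).
rewrite mulr0.
exact: (@cvg_mul0 R 0^'+ (fun e => if j == iv then e ^+ 2 else e)
  (fun=> p 0 j) (p 0 j) _ w0 (cvg_cst _)).
Qed.

Lemma indexP (i : 'I_n.+2) : [\/ i = iu, i = iv | exists k, i = ix k].
Proof.
case: (unliftP iu i) => [j ->|->]; last by constructor 1.
case: (unliftP ord0 j) => [k ->|->]; last by constructor 2.
by constructor 3; exists k.
Qed.

Lemma cvg_rescaled (U : set 'rV[R]_n.+2) G p :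
  open U -> (forall q, U q -> adapted_form (G q) /\ (G q)^T = G q) ->
  U (axis (p 0 iu)) -> {for axis (p 0 iu), continuous G} ->
  rescaled G e p @[e --> 0^'+] --> rosen_mx G p.
Proof.
move=> oU aG Up cG.
have nU : \forall e \near (0 : R)^'+, U (dilation e p).
  by apply: cvg_dilation; exact: open_nbhs_nbhs.
have ne : \forall e \near (0 : R)^'+, e != 0.
  by near=> e; apply: lt0r_neq0.
have e0 : e @[e --> (0:R)^'+] --> (0 : R) by exact: cvg_at_right_filter.
have cGij i j : G (dilation e p) i j @[e --> 0^'+] --> G (axis (p 0 iu)) i j.
  have cG' : G x @[x --> axis (p 0 iu)] --> G (axis (p 0 iu)) := cG.
  have H := cvg_comp (fun e => dilation e p) G (@cvg_dilation p) cG'.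
  exact: (cvg_comp _ (fun A : 'M[R]_n.+2 => A i j) H (@coord_continuous _ _ _ i j _)).
have eG i j (k : nat) : (0 < k)%N ->
    e ^+ k * G (dilation e p) i j @[e --> 0^'+] --> (0 : R).
  move=> k0; have ek : e ^+ k @[e --> (0:R)^'+] --> (0 : R).
    have := @exprn_continuous R k 0.
    rewrite /continuous_at expr0n eqn0Ngt k0 /= => H.
    exact: (@cvg_comp _ _ _ id (fun e => e ^+ k) _ _ _ e0 H).
  exact: (@cvg_mul0 R 0^'+ (fun e => e ^+ k)
    (fun e => G (dilation e p) i j) _ _ ek (cGij i j)).
apply: cvg_mx_entries => i j; rewrite mxE.
under eq_fun do rewrite rescaledE.
have vu : (iv : 'I_n.+2) == iu = false by [].
have xu (k : 'I_n) : (ix k == iu) = false by [].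
have xv (k : 'I_n) : (ix k == iv) = false by [].
have ux (k : 'I_n) : (iu == ix k) = false by [].
have uv : (iu : 'I_n.+2) == iv = false by [].
case: (indexP i) => [->|->|[k ->]]; case: (indexP j) => [->|->|[l ->]];
  rewrite /dilation_weight ?eqxx ?vu ?xu ?xv ?uv /=.
- apply: cvg_near_cst; near=> e.
  have Ue : U (dilation e p) by near: e.
  have [[-> _ _] _] := aG _ Ue.
  by rewrite !mulr0.
- apply: cvg_near_cst; near=> e.
  have Ue : U (dilation e p) by near: e.
  have [[_ -> _] _] := aG _ Ue.
  by rewrite mul1r mulr1 mulVf// expf_neq0//; near: e.
- apply: cvg_near_cst; near=> e.
  have Ue : U (dilation e p) by near: e.
  have [[_ _ ->] _] := aG _ Ue.
  by rewrite !mulr0.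
- apply: cvg_near_cst; near=> e.
  have Ue : U (dilation e p) by near: e.
  have [[_ H _] sG] := aG _ Ue.
  by rewrite -sG mxE H !mulr1 mulVf// expf_neq0//; near: e.
- apply: cvg_trans (eG iv iv 2%N isT); apply: near_eq_cvg; near=> e.
  rewrite -[e ^+ 2 * _ * _]mulrA mulKf// expf_neq0//; near: e.
- apply: cvg_trans (eG iv (ix l) 1%N isT); apply: near_eq_cvg; near=> e.
  rewrite -[e ^+ 2 * _ * _]mulrA expr1 mulKf// expf_neq0//; near: e.
- apply: cvg_near_cst; near=> e.
  have Ue : U (dilation e p) by near: e.
  have [[_ _ H] sG] := aG _ Ue.
  by rewrite -sG mxE H !mulr0.
- apply: cvg_trans (eG (ix k) iv 1%N isT); apply: near_eq_cvg; near=> e.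
  rewrite [e * e ^+ 2]mulrC -[e ^+ 2 * _ * _]mulrA expr1 mulKf// expf_neq0//; near: e.
- apply: cvg_trans (cGij (ix k) (ix l)); apply: near_eq_cvg; near=> e.
  rewrite -expr2 mulKf// expf_neq0//; near: e.
Unshelve. all: by end_near.
Qed.

Lemma penrose_limitE (U : set 'rV[R]_n.+2) G p :
  open U -> (forall q, U q -> adapted_form (G q) /\ (G q)^T = G q) ->
  U (axis (p 0 iu)) -> {for axis (p 0 iu), continuous G} ->
  penrose_limit G p = rosen_mx G p.
Proof.
by move=> oU aG Up cG; apply: cvg_lim => //; exact: (cvg_rescaled oU).
Qed.

End PenroseLimitFormula.

(* Main.v *)
Require Import Defs.
From HB Require Import structures.
From mathcomp Require Import all_boot all_order all_algebra.
From mathcomp Require Import all_classical all_reals all_analysis.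
From mathcomp Require Import ring.

Import Order.TTheory GRing.Theory Num.Theory.
Import numFieldNormedType.Exports.

Local Open Scope classical_set_scope.
Local Open Scope ring_scope.

(** Let T be the change of coordinates from the chart adapted to g to the chart
adapted to e^sigma g. Both charts put the geodesic on the axis, so T maps
(u,0,0) to (h(u),0,0), and it pulls the matrix of e^sigma g in the second chart
back to its matrix in the first. The Penrose limit is the limit of the metric
under the dilations Phi_e, up to the factor e^-2; hence if the rescaled maps
Phi_e^-1 o T o Phi_e converge, with their first derivatives, to a map F, then F
pulls the Penrose limit of e^sigma g back to e^(sigma(u,0,0)) times that of g:
this F is the required map, and its conformal factor depends on u only.

Convergence holds because T respects the weights (0,2,1) of (u,v,x) along the
axis. Write T = (U,V,X). On the axis V and X vanish, and so do their
u-derivatives. The first row of the Jacobian of T there is (h',0,0), and in an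
adapted chart the first row of the metric is (0,1,0); so the first row of the
pullback identity reads h' V_i = e^sigma if i is v and h' V_i = 0 otherwise.
Thus V_x = 0 on the axis ([transition_null]), and V is of weight 2. The limit
is [penrose_map T],
  F(u,v,x) = (h(u), V_v v + (1/2) V_xx(x,x), X_x x),
with all derivatives taken on the axis, at the point of parameter u.

Derivatives of the rescaled maps are derivatives of T on the curve e |-> Phi_e
p, divided by powers of e, and their limits are Taylor coefficients along that
curve ([taylor0], [taylor1], [taylor2]). They agree with the derivatives of F
because partial derivatives commute ([schwarz]); [cvg_rescaled_jacobian]
collects them, and [pullback_penrose_map] passes to the limit in the pullback
identity.

F is triangular: its u- and x-components do not involve v, and are inverted by
the same components of the map built from the inverse change of coordinates, by
the chain rule; then its v-component is solved for v. Since that inverse is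
written with derivatives of T and of its inverse, it is smooth ([penrose_inv],
[smooth_penrose_inv]).

Smoothness is given by iterated directional derivatives, so the calculus that
this uses is derived from that: a C^1 function of several coordinates is
differentiable ([C1_differentiable]), and smooth maps compose ([Ck_on_comp]).
*)

(** * Increments along lines and the symmetry of second derivatives *)

Lemma is_derive_affine {R : realType} {V V' W : normedModType R}
    (L : V -> V') (f : V' -> W) (a v : V) (w : V') (l : W) :
  (forall h : R, L (h *: v + a) = h *: w + L a) ->
  is_derive (L a) w f l -> is_derive a v (fun q => f (L q)) l.
Proof.
move=> La [df <-]; rewrite /derivable in df.
have E : (fun h : R => h^-1 *: (((fun q =>
  f (L q)) \o shift a) (h *: v) - f (L a)))
    = (fun h : R => h^-1 *: ((f \o shift (L a)) (h *: w) - f (L a))).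
  by apply/funext => h /=; rewrite La.
by split; rewrite /derivable /derive E.
Qed.

Section Line.
Context {R : realType} {V : normedModType R}.
Implicit Types (f : V -> R) (a v w : V).

Lemma is_derive_line f a v (t : R) : derivable f (a + t *: v) v ->
  is_derive t 1 (fun s : R => f (a + s *: v)) ('D_v f (a + t *: v)).
Proof.
move=> /derivableP; apply: (is_derive_affine (fun s : R => a + s *: v)) => h.
by rewrite [h%:A]mulr1 scalerDl addrCA.
Qed.

Lemma mvt_line f a v (c : R) :
  (forall t : R, `|t| <= `|c| -> derivable f (a + t *: v) v) ->
  exists2 t : R, `|t| <= `|c| & f (a + c *: v) - f a = c * 'D_v f (a + t *: v).
Proof.
move=> df; pose F (s : R) := f (a + s *: v).
have dF (t : R) : `|t| <= `|c| -> is_derive t 1 F ('D_v f (a + t *: v)).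
  by move=> /df; exact: is_derive_line.
have F0 : F 0 = f a by rewrite /F scale0r addr0.
have cF (x y : R) : (forall t, t \in `[x, y] -> `|t| <= `|c|) ->
    {within `[x, y], continuous F}.
  move=> xy; apply: derivable_within_continuous => t /xy tc.
  by have [] := dF _ tc.
have [c0|/ltW c0] := lerP 0 c.
  have tc (t : R) : t \in `[0, c] -> `|t| <= `|c|.
    by rewrite in_itv/= => /andP[t0 tc]; rewrite !ger0_norm.
  have [|t /tc tC] := @MVT_segment R F (fun t =>
    'D_v f (a + t *: v)) _ _ c0 _ (cF _ _ tc).
    by move=> x /subset_itv_oo_cc/tc/dF.
  by rewrite F0 subr0 => E; exists t => //; rewrite mulrC -E.
have tc (t : R) : t \in `[c, 0] -> `|t| <= `|c|.
  by rewrite in_itv/= => /andP[t0 tc]; rewrite !ler0_norm// lerN2.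
have [|t /tc tC] := @MVT_segment R F (fun t =>
  'D_v f (a + t *: v)) _ _ c0 _ (cF _ _ tc).
  by move=> x /subset_itv_oo_cc/tc/dF.
rewrite F0 sub0r => E; exists t => //.
by rewrite -[LHS]opprB E mulrN opprK mulrC.
Qed.

Lemma near_parallelogram (a v w : V) (P : set V) : nbhs a P ->
  exists2 d : R, 0 < d & forall s t : R, `|s| <= d -> `|t| <= d ->
    P (a + s *: v + t *: w).
Proof.
move=> /nbhs_ballP[r /= r0 rP].
have k0 : 0 < 1 + `|v| + `|w| by rewrite ltr_wpDr// ltr_wpDr.
exists (r / (1 + `|v| + `|w|)) => [|s t sd td]; first exact: divr_gt0.
apply: rP; rewrite -ball_normE/= -addrA opprD addNKr normrN.
rewrite (le_lt_trans (ler_normD _ _))// !normrZ.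
apply: (@le_lt_trans _ _ (r / (1 + `|v| + `|w|) * (`|v| + `|w|))).
  by rewrite mulrDr lerD// ler_wpM2r.
by rewrite -mulrA gtr_pMr// ltr_pdivrMl// mulr1 -addrA ltrDr.
Qed.

(** The second difference of f is an increment along v of q |-> f (q + d w) - f
q, and the derivative of the latter is an increment along w of the derivative
of f: two mean values. *)
Lemma second_difference (U : set V) f a v w (d : R) :
  (forall s t : R, `|s| <= `|d| -> `|t| <= `|d| -> U (a + s *: v + t *: w)) ->
  (forall p, U p -> derivable f p v) ->
  (forall p, U p -> derivable (fun q => 'D_v f q) p w) ->
  exists s t : R, [/\ `|s| <= `|d|, `|t| <= `|d| &
    f (a + d *: v + d *: w) - f (a + d *: v) - (f (a + d *: w) - f a) =
    d * (d * 'D_w (fun q => 'D_v f q) (a + s *: v + t *: w))].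
Proof.
move=> HU fv fvw; pose g q := f (q + d *: w) - f q.
have gd s : `|s| <= `|d| -> is_derive (a + s *: v) v g
    ('D_v f (a + s *: v + d *: w) - 'D_v f (a + s *: v)).
  move=> sd; have Up t := HU s t sd; apply: is_deriveB.
    apply: (is_derive_affine (fun q => q + d *: w)) => [h|];
      first by rewrite -addrA.
    by apply: derivableP; apply: fv; exact: Up.
  apply: derivableP; apply: fv; rewrite -[_ + _]addr0 -(scale0r w).
  by apply: Up; rewrite normr0.
have [s sd Eg] : exists2 s : R, `|s| <= `|d| &
    g (a + d *: v) - g a = d * 'D_v g (a + s *: v).
  by apply: mvt_line => s /gd[].
have [t td Et] : exists2 t : R, `|t| <= `|d| &
    'D_v f (a + s *: v + d *: w) - 'D_v f (a + s *: v) =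
    d * 'D_w (fun q => 'D_v f q) (a + s *: v + t *: w).
  by apply: (mvt_line (fun q => 'D_v f q)) => t td; exact: fvw (HU _ _ sd td).
exists s, t; split => //.
by rewrite -Et -(@derive_val _ _ _ _ _ _ _ (gd s sd)).
Qed.

(** [X] and [Y] stand for the two mixed derivatives in [schwarz]; they agree at
points that approach a, hence at a. *)
Lemma eq_at_limit (a v w : V) (X Y : V -> R) (r : R) : 0 < r ->
  {for a, continuous X} -> {for a, continuous Y} ->
  (forall d : R, 0 < d -> d <= r -> exists s t s' t' : R,
    [/\ [/\ `|s| <= d, `|t| <= d, `|s'| <= d & `|t'| <= d] &
    X (a + s *: v + t *: w) = Y (a + s' *: v + t' *: w)]) ->
  X a = Y a.
Proof.
move=> r0 cX cY XY; apply/eqP; rewrite -subr_eq0 -normr_le0.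
apply/ler_addgt0Pl => e e0; rewrite addr0.
have e20 : 0 < e / 2 by rewrite divr_gt0.
have nX : nbhs a (fun p => `|X a - X p| <= e/2) by move/cvgrPdist_le : cX;
  exact.
have nY : nbhs a (fun p => `|Y a - Y p| <= e/2) by move/cvgrPdist_le : cY;
  exact.
have [d d0 H] := near_parallelogram _ v w _ (filterI nX nY).
have [s [t [s' [t' [[]]]]]] := XY (Num.min d r)
  ltac:(by rewrite lt_min d0) ltac:(by rewrite ge_min lexx orbT).
rewrite !le_min => /andP[sd _] /andP[td _] /andP[sd' _] /andP[td' _] E.
have [e1 _] := H _ _ sd td; have [_ e2] := H _ _ sd' td'.
rewrite -(subrKA (X (a + s *: v + t *: w))) (le_trans (ler_normD _ _))//.
by rewrite [e]splitr lerD// E distrC.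
Qed.

(** The second difference is symmetric in v and w, so it is the value near a of
either mixed derivative, times d^2. *)
Lemma schwarz (U : set V) f a v w : open U -> U a ->
  (forall p, U p -> derivable f p v) -> (forall p, U p -> derivable f p w) ->
  (forall p, U p -> derivable (fun q => 'D_v f q) p w) ->
  (forall p, U p -> derivable (fun q => 'D_w f q) p v) ->
  {for a, continuous (fun p => 'D_w (fun q => 'D_v f q) p)} ->
  {for a, continuous (fun p => 'D_v (fun q => 'D_w f q) p)} ->
  'D_w (fun q => 'D_v f q) a = 'D_v (fun q => 'D_w f q) a.
Proof.
have swap (x y z t : R) : x - z - (y - t) = x - y - (z - t) by ring.
move=> oU Ua fv fw fvw fwv cvw cwv.
have nU : nbhs a U by apply: open_nbhs_nbhs.
have [r r0 H] := near_parallelogram _ v w _ nU.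
apply: (eq_at_limit _ v w _ _ _ r0 cvw cwv) => d d0 dr.
have dd : `|d| = d by rewrite gtr0_norm.
have [|s [t [sd td E1]]] := second_difference U f a v w d _ fv fvw.
  by move=> s t; rewrite dd => sd td; apply: H; exact: le_trans dr.
have [|s' [t' [sd' td' E2]]] := second_difference U f a w v d _ fw fwv.
  by move=> s' t'; rewrite dd addrAC => ? ?; apply: H; exact: le_trans dr.
rewrite dd in sd td sd' td'.
exists s, t, t', s'; split; first by split.
rewrite [a + t' *: v + _]addrAC.
apply: (mulfI (lt0r_neq0 d0)); apply: (mulfI (lt0r_neq0 d0)).
apply: etrans (esym E1) (etrans _ E2).
rewrite [a + d *: w + _]addrAC; exact: swap.
Qed.

End Line.

(** * C^k functions on an open set *)

Section Ck.
Context {R : realType} {V : normedModType R}.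
Implicit Types U : set V.

(** C^k on an open set depends only on the values there; this is what lets the
rules of derivation, valid on U only, be used inside an induction on k. *)
Lemma Ck_on_eq (W : normedModType R) k U (f g : V -> W) :
  open U -> (forall p, U p -> f p = g p) -> Ck_on k U f -> Ck_on k U g.
Proof.
move=> oU; move: f g.
have n (f g : V -> W) p : (forall p, U p -> f p = g p) -> U p ->
    \near p, f p = g p.
  move=> eqfg Up.
  by apply: filterS (open_nbhs_nbhs (conj oU Up)) => q; exact: eqfg.
have c (f g : V -> W) : (forall p, U p -> f p = g p) ->
    (forall p, U p -> {for p, continuous f}) ->
    forall p, U p -> {for p, continuous g}.
  move=> fg cf p Up; suff : g x @[x --> p] --> g p by [].
  rewrite -fg//; exact: cvg_trans (near_eq_cvg (n _ _ _ fg Up)) (cf _ Up).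
elim: k => [|k IH] f g fg /= [cf Df]; split=> //; try exact: c fg cf.
move=> v; have [df Ckf] := Df v; split=> [p Up|].
  exact: near_eq_derivable (n _ _ _ fg Up) (df _ Up).
apply: IH Ckf => p Up; exact: near_eq_derive (n _ _ _ fg Up).
Qed.

Lemma Ck_onW (W : normedModType R) k U (f : V -> W) :
  Ck_on k.+1 U f -> Ck_on k U f.
Proof.
elim: k f => [|k IH] f [cf Df]; first by [].
by split=> // v; have [df Ckf] := Df v; split => //; exact: IH.
Qed.

Lemma Ck_on_cst (W : normedModType R) k U (c : W) : Ck_on k U (fun=> c).
Proof.
elim: k c => [|k IH] c /=; first by split=> // p _; exact: cvg_cst.
split=> [p _|v]; first exact: cvg_cst.
split=> [p _|]; first exact: derivable_cst.
have -> : (fun p => 'D_v (fun=> c) p) = (fun=> 0).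
  by apply/funext => p; exact: derive_cst.
exact: IH.
Qed.

Lemma Ck_onD k U (f g : V -> R) : open U ->
  Ck_on k U f -> Ck_on k U g -> Ck_on k U (fun p => f p + g p).
Proof.
move=> oU; elim: k f g => [|k IH] f g /= [cf Df] [cg Dg].
  by split=> // p Up; apply: cvgD; [exact: cf|exact: cg].
split=> [p Up|v]; first by apply: cvgD; [exact: cf|exact: cg].
have [df Ckf] := Df v; have [dg Ckg] := Dg v; split=> [p Up|].
  by apply: derivableD; [exact: df|exact: dg].
apply: Ck_on_eq oU _ (IH _ _ Ckf Ckg) => p Up.
by rewrite -deriveD//; [exact: df|exact: dg].
Qed.

Lemma Ck_onM k U (f g : V -> R) : open U ->
  Ck_on k U f -> Ck_on k U g -> Ck_on k U (fun p => f p * g p).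
Proof.
move=> oU; elim: k f g => [|k IH] f g Cf Cg.
  case: Cf Cg => /= [cf _] [cg _].
  by split=> // p Up; apply: cvgM; [exact: cf|exact: cg].
have := Ck_onW _ _ _ _ Cf; have := Ck_onW _ _ _ _ Cg.
case: Cf Cg => /= [cf Df] [cg Dg] Cf Cg.
split=> [p Up|v]; first by apply: cvgM; [exact: cf|exact: cg].
have [df Ckf] := Df v; have [dg Ckg] := Dg v; split=> [p Up|].
  by apply: derivableM; [exact: df|exact: dg].
have H := Ck_onD _ _ _ _ oU (IH _ _ Cg Ckg) (IH _ _ Cf Ckf).
apply: Ck_on_eq oU _ H => p Up.
by rewrite deriveM//; [exact: df|exact: dg].
Qed.

Lemma Ck_on_sum (I : Type) (s : seq I) (P : pred I) k U
    (f : I -> V -> R) : open U ->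
  (forall i, Ck_on k U (f i)) -> Ck_on k U (fun p => \sum_(i <- s | P i) f i p).
Proof.
move=> oU Cf; elim: s => [|i s IH].
  by under eq_fun do rewrite big_nil; exact: Ck_on_cst.
under eq_fun do rewrite big_cons; case: (P i) => //.
exact: Ck_onD.
Qed.

Lemma Ck_on_mx (m n k : nat) U (f : V -> 'M[R]_(m, n)) : open U ->
  (forall i j, Ck_on k U (fun p => f p i j)) -> Ck_on k U f.
Proof.
move=> oU; elim: k f => [|k IH] f Cf.
  split=> // p Up; apply: cvg_mx_entries => i j.
  by have [+ _] := Cf i j; exact.
split=> [p Up|v].
  by apply: cvg_mx_entries => i j; have [+ _] := Cf i j; exact.
have df p : U p -> derivable f p v.
  move=> Up; apply/derivable_mxP => i j.
  by have [_ /(_ v)[+ _]] := Cf i j; exact.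
split=> //; apply: IH => i j; have [_ /(_ v)[_]] := Cf i j.
by apply: Ck_on_eq oU _ => p Up; rewrite derive_mx ?mxE//; exact: df.
Qed.

Lemma Ck_on_coord (m n k : nat) U (f : V -> 'M[R]_(m, n)) i j : open U ->
  Ck_on k U f -> Ck_on k U (fun p => f p i j).
Proof.
move=> oU; elim: k f => [|k IH] f /= [cf Df].
  split=> // p Up; apply: (cvg_comp f (fun A : 'M[R]_(m, n) => A i j)).
    exact: cf.
  exact: coord_continuous.
split=> [p Up|v].
  apply: (cvg_comp f (fun A : 'M[R]_(m, n) => A i j)); first exact: cf.
  exact: coord_continuous.
have [df Ckf] := Df v; split=> [p Up|].
  by have /derivable_mxP := df _ Up; exact.
apply: Ck_on_eq oU _ (IH _ Ckf) => p Up; rewrite derive_mx ?mxE//.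
exact: df.
Qed.

Lemma Ck_on_linear (W : normedModType R) k U (f : {linear V -> W}) :
  continuous f -> Ck_on k U f.
Proof.
move=> cf; case: k => [|k]; first by split=> // p _; exact: cf.
split=> [p _|v]; first exact: cf.
have df p : differentiable f p by exact: linear_differentiable.
split=> [p _|]; first exact: diff_derivable.
have -> : (fun p => 'D_v f p) = (fun=> f v).
  by apply/funext => p; rewrite deriveE// diff_lin.
exact: Ck_on_cst.
Qed.

End Ck.

(** * Differentiability and the chain rule *)

Lemma differentiable_of_approx {R : realType} {V W : normedModType R}
    (f : V -> W) (L : {linear V -> W}) (p : V) : continuous L ->
  (forall e : R, 0 < e ->
    \forall h \near (0 : V), `|f (h + p) - f p - L h| <= e * `|h|) ->
  differentiable f p.
Proof.
move=> cL H.
have E : f \o shift p = cst (f p) + L +o_ 0 id.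
  apply/eqaddoP => e e0; have := H e e0.
  by apply: filterS => h; rewrite -[f (h + p) - _ - _]addrA -opprD.
by apply/diff_locallyP; rewrite (diff_unique cL E).
Qed.

Section Chain.
Context {R : realType} {m : nat}.
Implicit Types (U : set 'rV[R]_m) (f : 'rV[R]_m -> R).

Lemma mx_norm_le (a b : nat) (A : 'M[R]_(a, b)) (c : R) : 0 <= c ->
  (forall i j, `|A i j| <= c) -> `|A| <= c.
Proof.
move=> c0 H; rewrite /Num.Def.normr/= mx_normrE.
by apply: bigmax_le => // -[i j] _; exact: H.
Qed.

Lemma coord_le_norm (a b : nat) (A : 'M[R]_(a, b)) i j : `|A i j| <= `|A|.
Proof.
rewrite [leRHS]/Num.Def.normr/= mx_normrE.
exact: (le_bigmax _ (fun ij : 'I_a * 'I_b => `|A ij.1 ij.2|) (i, j)).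
Qed.

(** The increment f (h + p) - f p is split into m increments along the
coordinate axes; by the mean value theorem each is a partial derivative at a
point near p times a coordinate of h. *)
Lemma C1_differentiable U f p : open U -> U p -> Ck_on 1 U f ->
  differentiable f p.
Proof.
move=> oU Up [_ Df].
pose L (h : 'rV[R]_m) := \sum_i h 0 i * partial i f p.
have Llin : linear L.
  move=> c x y; rewrite /L scaler_sumr -big_split/=; apply: eq_bigr => i _.
  by rewrite !mxE mulrDl -mulrA.
pose LM := GRing.isLinear.Build _ _ _ _ _ Llin.
pose Ll : {linear 'rV[R]_m -> R} := HB.pack L LM.
have cL : continuous Ll.
  have : Ck_on 0 setT L.
    apply: (Ck_on_sum _ _ xpredT 0 setT
      (fun i (h : 'rV[R]_m) => h 0 i * partial i f p)) => [|i].
      exact: openT.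
    apply: Ck_onM; [exact: openT| |exact: Ck_on_cst].
    by split=> // q _; exact: coord_continuous.
  by move=> [H _] q; apply: H.
apply: (differentiable_of_approx _ Ll _ cL) => e e0.
have e1 : 0 < e / m.+1%:R by rewrite divr_gt0.
have nH : \forall q \near p, forall i, U q /\
    `|partial i f p - partial i f q| <= e / m.+1%:R.
  apply: (@filter_forall _ _ _ (nbhs p) (nbhs_filter p)) => i.
  apply: filterI; first exact: open_nbhs_nbhs.
  have [_ [cDi _]] := Df (delta_mx 0 i).
  by have /cvgrPdist_le := cDi _ Up; exact.
have [r /= r0 rH] := (nbhs_ballP _ _).1 nH.
have nr : \forall h \near (0 : 'rV[R]_m), `|h| < r.
  apply/nbhs_ballP; exists r => // h; rewrite -ball_normE/= sub0r normrN.
  exact.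
apply: filterS nr => h hr.
pose hh j : 'rV[R]_m := \row_k (if (k < j)%N then h 0 k else 0).
have hh0 : hh 0%N = 0 by apply/rowP => k; rewrite !mxE.
have hhm : hh m = h by apply/rowP => k; rewrite !mxE ltn_ord.
have hhS (j : 'I_m) : hh j.+1 = hh j + h 0 j *: delta_mx 0 j.
  apply/rowP => k; rewrite !mxE eqxx/= ltnS leq_eqVlt.
  have [->|kj] := eqVneq k j; first by rewrite eqxx ltnn/= mulr1 add0r.
  by rewrite (negbTE (_ : (k : nat) != j))// mulr0 addr0.
have step (j : 'I_m) : `|f (p + hh j.+1) - f (p + hh j) - h 0 j * partial j f p|
    <= e / m.+1%:R * `|h|.
  have inb (t : R) : `|t| <= `|h 0 j| ->
      ball p r (p + hh j + t *: delta_mx 0 j).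
    move=> tj; rewrite -ball_normE/= -addrA opprD addNKr normrN.
    apply: le_lt_trans hr; apply: mx_norm_le => // i k;
      rewrite ord1 !mxE eqxx/=.
    have [->|kj] := eqVneq k j.
      by rewrite ltnn add0r mulr1 (le_trans tj)// coord_le_norm.
    rewrite mulr0 addr0; case: ifP => _; first exact: coord_le_norm.
    by rewrite normr0.
  have [|t tj E] := @mvt_line _ _ f (p + hh j) (delta_mx 0 j) (h 0 j).
    move=> t /inb/rH/(_ j)[Ut _].
    by have [+ _] := Df (delta_mx 0 j); exact.
  rewrite hhS addrA E -mulrBr normrM mulrC ler_pM//.
    by rewrite distrC; have [] := rH _ (inb _ tj) j.
  exact: coord_le_norm.
have -> : f (h + p) - f p - Ll h =
    \sum_(j < m) (f (p + hh j.+1) - f (p + hh j) - h 0 j * partial j f p).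
  rewrite big_split/= sumrN.
  rewrite -(big_mkord xpredT (fun j => f (p + hh j.+1) - f (p + hh j))).
  by rewrite (telescope_sumr (fun j => f (p + hh j)))// hh0 hhm addr0
    [p + h]addrC.
rewrite (le_trans (ler_norm_sum _ _ _))//.
rewrite (le_trans (ler_sum _ (fun j _ => step j)))// sumr_const card_ord.
rewrite -[leLHS]mulr_natl mulrA ler_wpM2r// mulrCA ger_pMr//.
by rewrite ler_pdivrMr// mul1r ler_nat.
Qed.

Lemma diff_partial f p (v : 'rV[R]_m) : differentiable f p ->
  'd f p v = \sum_i v 0 i * partial i f p.
Proof.
move=> df; rewrite {1}(row_sum_delta v) linear_sum; apply: eq_bigr => i _.
by rewrite linearZ /partial deriveE.
Qed.

Lemma derive_along_line {V W : normedModType R} (g : V -> W) (a v : V) :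
  'D_v g a = 'D_1 (fun t : R => g (t *: v + a)) 0.
Proof.
rewrite /derive; set g1 := fun h => h^-1 *: _; set g2 := fun h => h^-1 *: _.
suff -> : g1 = g2 by [].
by rewrite funeqE /g1 /g2 => h /=; rewrite addr0 scale0r add0r [_%:A]mulr1.
Qed.

(** On the line through a in the direction v the map g is a differentiable
curve, so this is the chain rule for the composition of f with a curve. *)
Lemma is_derive_chain {V : normedModType R} f (g : V -> 'rV[R]_m) (a v : V) :
  differentiable f (g a) -> derivable g a v ->
  is_derive a v (f \o g) (\sum_i 'D_v g a 0 i * partial i f (g a)).
Proof.
move=> df dg; pose G (t : R) := g (t *: v + a).
have dG : differentiable G 0.
  exact: (derivable1_diffP _ _).1 ((derivable1P _ _ _).1 dg).
have G0 : G 0 = g a by rewrite /G scale0r add0r.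
have dfG : differentiable f (G 0) by rewrite G0.
have dfoG : differentiable (f \o G) 0 by exact: differentiable_comp.
split.
  exact: (derivable1P _ _ _).2 ((derivable1_diffP _ _).2 dfoG).
have -> : 'D_v (f \o g) a = 'd f (G 0) ('d G 0 1).
  transitivity ('d (f \o G) 0 1); last by rewrite diff_comp.
  by rewrite -(@deriveE _ _ _ _ _ (1:R) dfoG) derive_along_line.
by rewrite diff_partial// G0 -(@deriveE _ _ _ _ _ (1:R) dG) -derive_along_line.
Qed.

(** By the chain rule the derivative of f o g is a sum of products of
derivatives of g with partial derivatives of f composed with g, to which the
induction hypothesis applies. *)
Lemma Ck_on_comp {V : normedModType R} k U f (W : set V) (g : V -> 'rV[R]_m) :
  open U -> open W -> (forall p, W p -> U (g p)) ->
  Ck_on k U f -> Ck_on k W g -> Ck_on k W (f \o g).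
Proof.
move=> oU oW WU; elim: k f g WU => [|k IH] f g WU Cf Cg.
  case: Cf Cg => /= [cf _] [cg _]; split=> // p Wp.
  by apply: continuous_comp; [exact: cg|apply: cf; exact: WU].
have C1 : Ck_on 1 U f.
  case: Cf => /= [cf Df]; split=> // v; have [? Ckf] := Df v; split=> //.
  by case: (k) Ckf => // ? [].
have Cg' := Ck_onW _ _ _ _ Cg.
case: Cf Cg => /= [cf Df] [cg Dg]; split=> [p Wp|v].
  by apply: continuous_comp; [exact: cg|apply: cf; exact: WU].
have [dg Ckg] := Dg v.
have H p : W p -> is_derive p v (f \o g)
    (\sum_i 'D_v g p 0 i * partial i f (g p)).
  move=> Wp; apply: is_derive_chain; last exact: dg.
  exact: C1_differentiable oU (WU _ Wp) C1.
split=> [p Wp|]; first by have [] := H _ Wp.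
apply: (Ck_on_eq _ _ _ (fun p => \sum_i 'D_v g p 0 i * partial i f (g p)) _ oW).
  by move=> p Wp; have [_ ->] := H _ Wp.
apply: (Ck_on_sum _ _ xpredT k W
  (fun i p => 'D_v g p 0 i * partial i f (g p))) => // i.
apply: (Ck_onM _ _ (fun p => 'D_v g p 0 i) (fun p => partial i f (g p))) => //.
  exact: (Ck_on_coord _ _ _ _ (fun p => 'D_v g p)).
apply: (IH (partial i f) g) => //.
by have [_] := Df (delta_mx 0 i).
Qed.

End Chain.

(** * Smooth functions of several coordinates *)

Section Smooth.
Context {R : realType} {m : nat}.
Implicit Types (U : set 'rV[R]_m) (f g : 'rV[R]_m -> R) (p : 'rV[R]_m).

Lemma smooth_cst U (c : R) : smooth_on U (fun=> c).
Proof. by move=> k; exact: Ck_on_cst. Qed.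

Lemma smoothD U f g : open U ->
  smooth_on U f -> smooth_on U g -> smooth_on U (fun p => f p + g p).
Proof. by move=> oU sf sg k; apply: Ck_onD. Qed.

Lemma smoothM U f g : open U ->
  smooth_on U f -> smooth_on U g -> smooth_on U (fun p => f p * g p).
Proof. by move=> oU sf sg k; apply: Ck_onM. Qed.

Lemma smooth_sum (I : finType) U (f : I -> 'rV[R]_m -> R) : open U ->
  (forall i, smooth_on U (f i)) -> smooth_on U (fun p => \sum_i f i p).
Proof. by move=> oU sf k; apply: Ck_on_sum => // i; exact: sf. Qed.

Lemma smooth_coordinate U i : open U -> smooth_on U (fun p : 'rV[R]_m => p 0 i).
Proof.
move=> oU k; apply: (Ck_on_coord 1 m k U id 0 i) => //.
apply: (Ck_on_linear _ k U (idfun : {linear 'rV[R]_m -> 'rV[R]_m})).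
by move=> q; exact: cvg_id.
Qed.

Lemma smooth_row (l : nat) U (T : 'rV[R]_m -> 'rV[R]_l) : open U ->
  (forall j, smooth_on U (fun p => T p 0 j)) -> smooth_on U T.
Proof.
by move=> oU sT k; apply: Ck_on_mx => // i j; rewrite ord1; exact: sT.
Qed.

Lemma smooth_component (l : nat) U (T : 'rV[R]_m -> 'rV[R]_l) j : open U ->
  smooth_on U T -> smooth_on U (fun p => T p 0 j).
Proof. by move=> oU sT k; apply: Ck_on_coord. Qed.

Lemma smooth_comp (l : nat) U (W : set 'rV[R]_l) f (T : 'rV[R]_l -> 'rV[R]_m) :
  open U -> open W -> (forall q, W q -> U (T q)) ->
  smooth_on U f -> smooth_on W T -> smooth_on W (fun q => f (T q)).
Proof. by move=> oU oW WU sf sT k; apply: (Ck_on_comp _ U). Qed.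

Lemma smooth_partial U f i : smooth_on U f -> smooth_on U (partial i f).
Proof. by move=> sf k; have [_ /(_ (delta_mx 0 i))[]] := sf k.+1. Qed.

Lemma smooth_continuous {V W : normedModType R} (U : set V)
    (F : V -> W) (p : V) :
  smooth_on U F -> U p -> {for p, continuous F}.
Proof. by move=> sF Up; have [+ _] := sF 0%N; exact. Qed.

Lemma smooth_derivable {V W : normedModType R} (U : set V)
    (F : V -> W) (p v : V) :
  smooth_on U F -> U p -> derivable F p v.
Proof. by move=> sF Up; have [_ /(_ v)[+ _]] := sF 1%N; exact. Qed.

Lemma smooth_differentiable U f p : open U -> smooth_on U f -> U p ->
  differentiable f p.
Proof. by move=> oU sf Up; exact: C1_differentiable oU Up (sf 1%N). Qed.

Lemma smooth_row_differentiable (l : nat) U (T : 'rV[R]_m -> 'rV[R]_l) p :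
  open U -> smooth_on U T -> U p -> differentiable T p.
Proof.
move=> oU sT Up.
have -> : T = \sum_j (fun q => T q 0 j *: delta_mx 0 j).
  apply/funext => q; rewrite fct_sumE; exact: row_sum_delta.
apply: differentiable_sum => j; apply: differentiableZl.
by apply: (smooth_differentiable U) => //; exact: smooth_component.
Qed.

Lemma partialC U f i j p : open U -> smooth_on U f -> U p ->
  partial i (partial j f) p = partial j (partial i f) p.
Proof.
move=> oU sf Up; have sfi := smooth_partial _ _ i sf.
have sfj := smooth_partial _ _ j sf.
apply: (schwarz U f p (delta_mx 0 j) (delta_mx 0 i)) => //.
- by move=> q; exact: smooth_derivable.
- by move=> q; exact: smooth_derivable.
- by move=> q Uq; exact: (smooth_derivable _ _ _ _ sfj Uq).
- by move=> q Uq; exact: (smooth_derivable _ _ _ _ sfi Uq).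
- exact: (smooth_continuous _ _ _ (smooth_partial _ _ i sfj) Up).
- exact: (smooth_continuous _ _ _ (smooth_partial _ _ j sfi) Up).
Qed.

Lemma jacobianE (l : nat) (T : 'rV[R]_m -> 'rV[R]_l) p i j :
  differentiable T p -> jacobian T p i j = partial i (fun q => T q 0 j) p.
Proof.
move=> dT; have dTi : derivable T p (delta_mx 0 i) by exact: diff_derivable.
have := deriveEjacobian (delta_mx 0 i) dT.
rewrite -rowE derive_mx// => /rowP/(_ j); rewrite !mxE => <-.
by [].
Qed.

Lemma partial_coordinate i j p :
  is_derive p (delta_mx 0 i) (fun q : 'rV[R]_m => q 0 j) (j == i)%:R.
Proof.
have dj := differentiable_coord p 0 j.
split; first exact: diff_derivable.
transitivity ('D_(delta_mx 0 i) (@id 'rV[R]_m) p 0 j).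
  by rewrite derive_mx ?mxE//; exact: derivable_id.
by rewrite derive_id mxE.
Qed.

Lemma is_derive_bigsum {V : normedModType R} (I : finType)
    (h : I -> V -> R) (x v : V) (dh : I -> R) :
  (forall i, is_derive x v (h i) (dh i)) ->
  is_derive x v (fun q => \sum_i h i q) (\sum_i dh i).
Proof.
move=> H; have -> : (fun q => \sum_i h i q) = \sum_i h i.
  by apply/funext => q; rewrite fct_sumE.
by elim/big_ind2 : _ => // [|] *; [exact: is_derive_cst|exact: is_deriveD].
Qed.

End Smooth.

(** * The limit of the rescaled coordinate changes *)

Section Model.
Context {R : realType} {n : nat}.
Implicit Types (p q : 'rV[R]_n.+2) (f : 'rV[R]_n.+2 -> R)
  (T : 'rV[R]_n.+2 -> 'rV[R]_n.+2) (U : set 'rV[R]_n.+2) (J : set R).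

Definition axis_proj p : 'rV[R]_n.+2 := axis (p 0 iu).
Definition component T j : 'rV[R]_n.+2 -> R := fun q => T q 0 j.

(** First and second differential on the axis, on the x-part of p. *)
Definition transverse_diff f p : R :=
  \sum_(k < n) p 0 (ix k) * partial (ix k) f (axis_proj p).
Definition transverse_hess f p : R :=
  \sum_(k < n) p 0 (ix k) * transverse_diff (partial (ix k) f) p.

(** The pointwise limit of Phi_e^-1 o T o Phi_e, where Phi_e is [dilation e],
for T that preserves the axis and has V_x = 0 on it (V the v-component). *)
Definition penrose_map T p : 'rV[R]_n.+2 := \row_j
  if j == iu then T (axis_proj p) 0 iu
  else if j == iv then
    p 0 iv * partial iv (component T iv) (axis_proj p) +
    2^-1 * transverse_hess (component T iv) p
  else transverse_diff (component T j) p.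

Lemma ixu (k : 'I_n) : (ix k == iu) = false. Proof. by []. Qed.
Lemma ixv (k : 'I_n) : (ix k == iv) = false. Proof. by []. Qed.
Lemma ivu : (iv == iu :> 'I_n.+2) = false. Proof. by []. Qed.
Lemma iuv : (iu == iv :> 'I_n.+2) = false. Proof. by []. Qed.
Lemma iux (k : 'I_n) : (iu == ix k) = false. Proof. by []. Qed.
Lemma ivx (k : 'I_n) : (iv == ix k) = false. Proof. by []. Qed.
Lemma ixx (k l : 'I_n) : (ix k == ix l) = (k == l).
Proof. by []. Qed.

Definition ixE := (ixu, ixv, ivu, iuv, iux, ivx, ixx, eqxx).

Lemma sum_uvx (V : nmodType) (G : 'I_n.+2 -> V) :
  \sum_i G i = G iu + G iv + \sum_(k < n) G (ix k).
Proof. by rewrite !big_ord_recl addrA. Qed.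

Lemma axisE (u : R) j : (axis u : 'rV[R]_n.+2) 0 j = if j == iu then u else 0.
Proof.
by rewrite !mxE eqxx/=; case: (j == iu); rewrite ?mulr1 ?mulr0.
Qed.

Lemma axis_u (u : R) : (axis u : 'rV[R]_n.+2) 0 iu = u.
Proof. by rewrite axisE. Qed.

Lemma penrose_mapE T p j : penrose_map T p 0 j =
  if j == iu then T (axis_proj p) 0 iu
  else if j == iv then
    p 0 iv * partial iv (component T iv) (axis_proj p) +
    2^-1 * transverse_hess (component T iv) p
  else transverse_diff (component T j) p.
Proof. by rewrite mxE. Qed.

Lemma penrose_domain_open J : open J -> open (@penrose_domain R n J).
Proof.
move=> oJ.
have -> : penrose_domain J = (fun p : 'rV[R]_n.+2 => p 0 iu) @^-1` J by [].
by apply: open_comp => // p _; exact: coord_continuous.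
Qed.

Section Smoothness.
Variables (U : set 'rV[R]_n.+2) (J : set R).
Hypotheses (oU : open U) (oJ : open J) (JU : forall u, J u -> U (axis u)).
Let D : set 'rV[R]_n.+2 := penrose_domain J.
Let oD : open D. Proof. exact: penrose_domain_open. Qed.
Let DU p : D p -> U (axis_proj p). Proof. exact: JU. Qed.

Lemma smooth_axis_proj f : smooth_on U f ->
  smooth_on D (fun p => f (axis_proj p)).
Proof.
move=> sf; apply: (smooth_comp _ U D f axis_proj) => //.
apply: smooth_row => // j.
under eq_fun do rewrite /axis_proj axisE.
by case: (j == iu); [exact: smooth_coordinate|exact: smooth_cst].
Qed.

Lemma smooth_transverse_diff f :
  smooth_on U f -> smooth_on D (transverse_diff f).
Proof.
move=> sf; apply: (smooth_sum _ D (fun k p => p 0 (ix k) * _)) => // k.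
apply: (smoothM D (fun p => p 0 (ix k))) => //; first exact: smooth_coordinate.
by apply: smooth_axis_proj; exact: smooth_partial.
Qed.

Lemma smooth_transverse_hess f :
  smooth_on U f -> smooth_on D (transverse_hess f).
Proof.
move=> sf; apply: (smooth_sum _ D (fun k p => p 0 (ix k) * _)) => // k.
apply: (smoothM D (fun p => p 0 (ix k))) => //; first exact: smooth_coordinate.
by apply: smooth_transverse_diff; exact: smooth_partial.
Qed.

Lemma smooth_penrose_map T :
  smooth_on U T -> smooth_on D (penrose_map T).
Proof.
move=> sT; have sTj j : smooth_on U (component T j) by exact: smooth_component.
apply: smooth_row => // j; under eq_fun do rewrite penrose_mapE.
case: (j == iu); first exact: (smooth_axis_proj _ (sTj iu)).
case: (j == iv); last exact: (smooth_transverse_diff _ (sTj j)).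
apply: (smoothD D (fun p => p 0 iv * _)) => //.
  apply: (smoothM D (fun p => p 0 iv)) => //; first exact: smooth_coordinate.
  by apply: smooth_axis_proj; exact: smooth_partial.
apply: (smoothM D (fun=> 2^-1)) => //; first exact: smooth_cst.
exact: smooth_transverse_hess.
Qed.

Lemma is_derive_axis_proj f p i : D p -> smooth_on U f ->
  is_derive p (delta_mx 0 i) (fun q => f (axis_proj q))
    ((i == iu)%:R * partial iu f (axis_proj p)).
Proof.
move=> Dp sf.
have E (w : 'rV[R]_n.+2) : w = (if i == iu then delta_mx 0 iu else 0) ->
  forall h : R, axis_proj (h *: delta_mx 0 i + p) = h *: w + axis_proj p.
  move=> -> h; rewrite /axis_proj; apply/rowP => j; rewrite !mxE.
  have [_|_] := eqVneq i iu; first by rewrite !mxE !eqxx/= mulr1 mulrDl.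
  by rewrite mxE andbF !mulr0 !add0r.
have [iE|iN] := eqVneq i iu.
  rewrite mul1r; apply: (is_derive_affine axis_proj f p _ (delta_mx 0 iu)).
    by apply: E; rewrite iE eqxx.
  by apply: derivableP; apply: smooth_derivable sf (DU _ Dp).
rewrite mul0r; apply: (is_derive_affine axis_proj f p _ 0).
  by apply: E; rewrite (negbTE iN).
exact: is_derive0.
Qed.

Lemma is_derive_transverse_diff f p i : D p -> smooth_on U f ->
  is_derive p (delta_mx 0 i) (transverse_diff f)
    ((i == iu)%:R * transverse_diff (partial iu f) p +
     \sum_(k < n) (ix k == i)%:R * partial (ix k) f (axis_proj p)).
Proof.
move=> Dp sf; have H k := is_deriveM
  (partial_coordinate i (ix k) p)
  (is_derive_axis_proj _ _ i Dp (smooth_partial _ _ (ix k) sf)).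
apply: (is_derive_eq (is_derive_bigsum _ _ _ _ _ H)).
rewrite /transverse_diff mulr_sumr -big_split/=.
apply: eq_bigr => k _; rewrite (partialC U f iu)//; last exact: DU.
by rewrite /GRing.scale/= mulrCA [X in _ + X]mulrC.
Qed.

(** The two arguments agree near the axis, and only their germs matter. *)
Lemma transverse_diffC f p i j : D p -> smooth_on U f ->
  transverse_diff (partial i (partial j f)) p =
  transverse_diff (partial j (partial i f)) p.
Proof.
move=> Dp sf.
have E q : U q -> partial i (partial j f) q = partial j (partial i f) q.
  exact: partialC.
have nE : \forall q \near axis_proj p,
    partial i (partial j f) q = partial j (partial i f) q.
  exact: filterS E (open_nbhs_nbhs (conj oU (DU _ Dp))).
have Ek k := near_eq_derive (delta_mx 0 (ix k)) nE.
by apply: eq_bigr => k _; exact: (congr1 ( *%R (p 0 (ix k))) (Ek k)).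
Qed.

(** The derivative of [transverse_hess f] by the product rule, as an identity
between numbers: [M k l], [t k] stand for second derivatives of f and their
contraction with x, and [a k] for the contraction of third derivatives. *)
Lemma sum_hess_split (x d a a' t : 'I_n -> R) (M : 'I_n -> 'I_n -> R) (b : R) :
  (forall k, a k = a' k) -> (forall k l, M l k = M k l) ->
  (forall l, t l = \sum_k x k * M k l) ->
  \sum_k (x k * (b * a k + \sum_l d l * M l k) + t k * d k) =
  b * (\sum_k x k * a' k) + \sum_k d k * t k + \sum_k d k * t k.
Proof.
move=> aa' MC tE; rewrite big_split/=; congr (_ + _); last first.
  by apply: eq_bigr => k _; rewrite mulrC.
under eq_bigr do rewrite mulrDr aa'; rewrite big_split/= mulr_sumr.
congr (_ + _); first by apply: eq_bigr => k _; rewrite mulrCA.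
under eq_bigr do rewrite mulr_sumr; rewrite exchange_big/=.
apply: eq_bigr => k _; rewrite tE mulr_sumr; apply: eq_bigr => l _.
by rewrite mulrCA MC.
Qed.

Lemma is_derive_transverse_hess f p i : D p -> smooth_on U f ->
  is_derive p (delta_mx 0 i) (transverse_hess f)
    ((i == iu)%:R * transverse_hess (partial iu f) p +
     \sum_(k < n) (ix k == i)%:R * transverse_diff (partial (ix k) f) p +
     \sum_(k < n) (ix k == i)%:R * transverse_diff (partial (ix k) f) p).
Proof.
move=> Dp sf; have H k := is_deriveM
  (partial_coordinate i (ix k) p)
  (is_derive_transverse_diff _ _ i Dp (smooth_partial _ _ (ix k) sf)).
apply: (is_derive_eq (is_derive_bigsum _ _ _ _ _ H)).
exact: (sum_hess_split _ _ _ _ _ _ _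
  (fun k => transverse_diffC f p iu (ix k) Dp sf)
  (fun k l => partialC U f (ix l) (ix k) _ oU sf (DU _ Dp)) (fun=> erefl)).
Qed.

Section Jacobian.
Variable T : 'rV[R]_n.+2 -> 'rV[R]_n.+2.
Hypothesis sT : smooth_on U T.

Let sTj j : smooth_on U (component T j).
Proof. exact: smooth_component. Qed.

Lemma partial_penrose_map_u p i : D p ->
  partial i (component (penrose_map T) iu) p =
  (i == iu)%:R * partial iu (component T iu) (axis_proj p).
Proof.
move=> Dp.
have -> : component (penrose_map T) iu = fun q => component T iu (axis_proj q).
  by apply/funext => q; rewrite /component penrose_mapE.
by have [] := is_derive_axis_proj _ _ i Dp (sTj iu).
Qed.

Lemma partial_penrose_map_v p i : D p ->
  partial i (component (penrose_map T) iv) p =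
  (i == iv)%:R * partial iv (component T iv) (axis_proj p) +
  (i == iu)%:R *
    (p 0 iv * partial iv (partial iu (component T iv)) (axis_proj p) +
    2^-1 * transverse_hess (partial iu (component T iv)) p) +
  \sum_(k < n)
    (ix k == i)%:R * transverse_diff (partial (ix k) (component T iv)) p.
Proof.
move=> Dp; set V := component T iv.
have -> : component (penrose_map T) iv = fun q =>
    q 0 iv * partial iv V (axis_proj q) + 2^-1 * transverse_hess V q.
  by apply/funext => q; rewrite /component penrose_mapE.
have H1 := is_deriveM
  (partial_coordinate i iv p)
  (is_derive_axis_proj _ _ i Dp (smooth_partial _ _ iv (sTj iv))).
have H2 := is_deriveM (is_derive_cst (2^-1 : R) p (delta_mx 0 i))
  (is_derive_transverse_hess _ _ i Dp (sTj iv)).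
have [_ E] := is_deriveD H1 H2; apply: (etrans E).
have := partialC U V iu iv _ oU (sTj iv) (DU _ Dp).
move: (partial iu (partial iv V) _) (partial iv (partial iu V) _) => X Y ->.
rewrite /GRing.scale/= mulr0 addr0 [iv == i]eq_sym.
move: (\sum_(k < n) _) => S; have two : 2 != 0 :> R by rewrite pnatr_eq0.
by field.
Qed.

Lemma partial_penrose_map_x p i j : D p ->
  partial i (component (penrose_map T) (ix j)) p =
  (i == iu)%:R * transverse_diff (partial iu (component T (ix j))) p +
  \sum_(k < n)
    (ix k == i)%:R * partial (ix k) (component T (ix j)) (axis_proj p).
Proof.
move=> Dp.
have -> : component (penrose_map T) (ix j) =
    transverse_diff (component T (ix j)).
  by apply/funext => q; rewrite /component penrose_mapE.
by have [] := is_derive_transverse_diff _ _ i Dp (sTj (ix j)).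
Qed.

End Jacobian.

End Smoothness.
End Model.

(** * Taylor expansion on the curves of the dilations *)

Section Taylor.
Context {R : realType} {n : nat}.
Implicit Types (p q : 'rV[R]_n.+2) (f : 'rV[R]_n.+2 -> R) (U : set 'rV[R]_n.+2).

Definition dilation_speed (e : R) (i : 'I_n.+2) : R :=
  if i == iu then 0 else if i == iv then 2 * e else 1.

Lemma is_derive_dilation_coordinate (e : R) p i :
  is_derive e 1 (fun e => dilation e p 0 i) (dilation_speed e i * p 0 i).
Proof.
have -> : (fun e => dilation e p 0 i) =
    (fun e : R => dilation_weight e i * p 0 i).
  by apply/funext => x; rewrite mxE.
rewrite /dilation_weight /dilation_speed; case: (i == iu).
  by rewrite mul0r; exact: is_derive_cst.
case: (i == iv).
  apply: (is_derive_eq (is_deriveM (is_deriveX 2 (is_derive_id e 1))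
    (is_derive_cst (p 0 i) e 1))).
  by rewrite /GRing.scale/= mulr0 add0r expr1 mulr1 mulrC.
apply: (is_derive_eq (is_deriveM (is_derive_id e 1)
  (is_derive_cst (p 0 i) e 1))).
by rewrite /GRing.scale/= mulr0 add0r mulr1 mul1r.
Qed.

Lemma is_derive_dilation U f (e : R) p : open U -> smooth_on U f ->
  U (dilation e p) ->
  is_derive e 1 (fun e => f (dilation e p))
    (\sum_i dilation_speed e i * p 0 i * partial i f (dilation e p)).
Proof.
move=> oU sf Ue; pose c (e : R) : 'rV[R]_n.+2 := dilation e p.
have dc : derivable c e 1.
  by apply/derivable_mxP => i j; rewrite ord1;
    have [] := is_derive_dilation_coordinate e p j.
apply: (is_derive_eq (is_derive_chain f c e 1
  (smooth_differentiable U f _ oU sf Ue) dc)).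
apply: eq_bigr => i _; rewrite derive_mx// mxE.
by have [_ ->] := is_derive_dilation_coordinate e p i.
Qed.

Lemma dilation0 p : dilation 0 p = axis_proj p.
Proof.
apply/rowP => j; rewrite axisE mxE /dilation_weight expr0n/=.
have [->|_] := eqVneq j iu; first by rewrite mul1r.
by case: (j == iv); rewrite mul0r.
Qed.

Lemma sum_dilation_speed (e : R) p (G : 'I_n.+2 -> R) :
  \sum_i dilation_speed e i * p 0 i * G i =
  2 * e * p 0 iv * G iv + \sum_(k < n) p 0 (ix k) * G (ix k).
Proof.
rewrite sum_uvx /dilation_speed !ixE !mul0r add0r; congr (_ + _).
by apply: eq_bigr => k _; rewrite !ixE mul1r.
Qed.

Lemma taylor0 f p : {for axis_proj p, continuous f} ->
  f (dilation e p) @[e --> 0^'+] --> f (axis_proj p).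
Proof.
move=> cf; have cf' : f x @[x --> axis_proj p] --> f (axis_proj p) := cf.
exact: (cvg_comp (fun e => dilation e p) f (@cvg_dilation R n p) cf').
Qed.

Lemma cvg_bigsum (T : Type) (F : set_system T) (I : finType) (g : I -> T -> R)
    (l : I -> R) : Filter F ->
  (forall i, g i x @[x --> F] --> l i) ->
  \sum_i g i x @[x --> F] --> \sum_i l i.
Proof.
move=> FF gl; have -> : (fun x => \sum_i g i x) = \sum_i g i.
  by apply/funext => x; rewrite fct_sumE.
by elim/big_ind2 : _ => // [|u a v b ua vb]; [exact: cvg_cst|exact: cvgD].
Qed.

(** The velocity of e |-> Phi_e p at e = 0 is the x-part of p, since v is
scaled by e^2. *)
Lemma taylor1 U f p : open U -> U (axis_proj p) -> smooth_on U f ->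
  f (axis_proj p) = 0 ->
  e^-1 * f (dilation e p) @[e --> 0^'+] --> transverse_diff f p.
Proof.
move=> oU Up sf f0.
have := is_derive_dilation U f 0 p oU sf; rewrite dilation0 => /(_ Up)[].
rewrite sum_dilation_speed mulr0 !mul0r add0r => df;
  rewrite -/(transverse_diff f p) => <-.
move/cvg_dnbhs_at_right : (df : cvg _); rewrite /derive.
set F := (fun h : R => h^-1 *: _).
have -> : F = (fun e => e^-1 * f (dilation e p)).
  by apply/funext => h; rewrite /F/= dilation0 f0 subr0 addr0 [h%:A]mulr1.
exact.
Qed.

(** By l'Hopital's rule: the derivative of f on the curve is 2 e v f_v + x f_x,
and after division by 2 e its second term is handled by [taylor1]. *)
Lemma taylor2 U f p : open U -> U (axis_proj p) -> smooth_on U f ->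
  f (axis_proj p) = 0 -> (forall k, partial (ix k) f (axis_proj p) = 0) ->
  e ^- 2 * f (dilation e p) @[e --> 0^'+] -->
    p 0 iv * partial iv f (axis_proj p) + 2^-1 * transverse_hess f p.
Proof.
move=> oU Up sf f0 fk0.
have nU : \forall e \near (0 : R)^'+, U (dilation e p).
  by apply: cvg_dilation; exact: open_nbhs_nbhs.
have [b b0 bU] : exists2 b : R, 0 < b &
    forall e, e \in `]0, b[ -> U (dilation e p).
  have [b /= b0 bU] := (nbhs_ballP _ _).1 nU; exists b => // e.
  rewrite in_itv/= => /andP[e0 eb]; apply: bU => //.
  by rewrite /ball/= sub0r normrN gtr0_norm.
pose F e := f (dilation e p).
pose dF e := \sum_i dilation_speed e i * p 0 i * partial i f (dilation e p).
have dFE e : e \in `]0, b[ -> is_derive e 1 F (dF e).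
  by move=> /bU Ue; exact: is_derive_dilation Ue.
have sqE e : e \in `]0, b[ -> is_derive e 1 (fun x : R => x ^+ 2) (2 * e).
  move=> _; apply: (is_derive_eq (is_deriveX 2 (is_derive_id e 1))).
  by rewrite /GRing.scale/= expr1 mulr1.
have F0 : F e @[e --> 0^'+] --> 0.
  by have := taylor0 f p (smooth_continuous _ _ _ sf Up); rewrite f0.
have e0 : e @[e --> (0:R)^'+] --> (0 : R) by exact: cvg_at_right_filter.
have sq0 : e ^+ 2 @[e --> 0^'+] --> (0 : R).
  by under eq_fun do rewrite expr2; exact: (@cvg_mul0 R R 0^'+ id id 0).
have sqN0 e : e \in `]0, b[ -> 2 * e != 0.
  by rewrite in_itv/= => /andP[e0' _]; rewrite mulf_neq0 ?pnatr_eq0// gt_eqF.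
suff H : dF e / (2 * e) @[e --> 0^'+] -->
    p 0 iv * partial iv f (axis_proj p) + 2^-1 * transverse_hess f p.
  have := lhopital_at_right b0 dFE sqE F0 sq0 sqN0 H.
  by under eq_fun do rewrite mulrC.
have ne : \forall e \near (0 : R)^'+, e != 0 by near=> e; apply: lt0r_neq0.
have : p 0 iv * partial iv f (dilation e p) + 2^-1 *
    \sum_(k < n) p 0 (ix k) * (e^-1 * partial (ix k) f (dilation e p))
    @[e --> 0^'+] -->
    p 0 iv * partial iv f (axis_proj p) + 2^-1 * transverse_hess f p.
  apply: cvgD; apply: cvgM; try exact: cvg_cst.
    apply: taylor0; apply: smooth_continuous Up; exact: smooth_partial.
  apply: cvg_bigsum => k; apply: cvgM; first exact: cvg_cst.
  apply: (taylor1 U) => //; exact: smooth_partial.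
apply: cvg_trans; apply: near_eq_cvg; near=> e.
rewrite /dF sum_dilation_speed.
have e1 : e != 0 by near: e.
have two : 2 != 0 :> R by rewrite pnatr_eq0.
under eq_bigr do rewrite mulrCA; rewrite -mulr_sumr.
by field; rewrite e1.
Unshelve. all: by end_near. Qed.

End Taylor.

(** * Limits of the rescaled Jacobian and of the rescaled metric *)

Section Limit.
Context {R : realType} {n : nat}.
Implicit Types (p q : 'rV[R]_n.+2) (f : 'rV[R]_n.+2 -> R) (u : R)
  (U : set 'rV[R]_n.+2) (G : 'rV[R]_n.+2 -> 'M[R]_n.+2).

Lemma partial_along_axis (J : set R) f (c u : R) : open J -> J u ->
  (forall t, J t -> f (axis t) = c) -> partial iu f (axis u) = 0.
Proof.
move=> oJ Ju fc; rewrite /partial derive_along_line.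
have nJ : \forall t \near (0 : R), f (t *: delta_mx 0 iu + axis u) = cst c t.
  have : \forall t \near (0 : R), J (t + u).
    have cu : t + u @[t --> (0:R)] --> 0 + u.
      by apply: cvgD; [exact: cvg_id|exact: cvg_cst].
    by rewrite add0r in cu; apply: cu; exact: open_nbhs_nbhs.
  by apply: filterS => t /fc; rewrite /axis -scalerDl.
rewrite (near_eq_derive (1 : R) nJ); exact: derive_cst.
Qed.

Lemma cvg_mul_weight (w w' g : R -> R) (l : R) :
  (forall e, e != 0 -> w e = w' e) ->
  w' e * g e @[e --> 0^'+] --> l -> w e * g e @[e --> 0^'+] --> l.
Proof.
move=> ww'; apply: cvg_trans; apply: near_eq_cvg; near=> e.
by rewrite ww'//; near: e; near=> e; apply: lt0r_neq0.
Unshelve. all: by end_near. Qed.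

Lemma cvg_expr0 k : (0 < k)%N -> e ^+ k @[e --> (0:R)^'+] --> (0 : R).
Proof.
move=> k0; have := @exprn_continuous R k 0.
rewrite /continuous_at expr0n eqn0Ngt k0 /= => H.
exact: (@cvg_comp _ _ _ id (fun e => e ^+ k) _ _ _
  (cvg_at_right_filter cvg_id) H).
Qed.

Lemma sum_pick (I : finType) (G : I -> R) m :
  \sum_k (k == m)%:R * G k = G m.
Proof.
rewrite (bigD1 m)//= eqxx mul1r big1 ?addr0// => k /negbTE ->.
by rewrite mul0r.
Qed.

Section RescaledJacobian.
Variables (U : set 'rV[R]_n.+2) (J : set R) (T : 'rV[R]_n.+2 -> 'rV[R]_n.+2).
Hypotheses (oU : open U) (oJ : open J) (JU : forall u, J u -> U (axis u)).
Hypothesis sT : smooth_on U T.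
Hypothesis Taxis : forall u, J u -> T (axis u) = axis (T (axis u) 0 iu).
Hypothesis Tnull : forall u k, J u ->
  partial (ix k) (component T iv) (axis u) = 0.

Let sTj j : smooth_on U (component T j).
Proof. exact: smooth_component. Qed.

(** Entries of the Jacobian of Phi_e^-1 o T o Phi_e at p. An entry is divided
by e or e^2 only where the derivative of T vanishes to that order on the axis:
the u-derivatives of V and X because T preserves the axis, V_x by hypothesis,
and the x-derivatives of V_u, which are also the u-derivatives of V_x. *)
Lemma cvg_rescaled_jacobian p i j : J (p 0 iu) ->
  dilation_weight e i / dilation_weight e j *
    partial i (component T j) (dilation e p) @[e --> 0^'+] -->
  partial i (component (penrose_map T) j) p.
Proof.
move=> Jp; have Up : U (axis_proj p) by exact: JU.
have c0 i' j' : partial i' (component T j') (dilation e p) @[e --> 0^'+] -->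
    partial i' (component T j') (axis_proj p).
  by apply: taylor0; apply: smooth_continuous Up; exact: smooth_partial.
have Du j' : j' != iu -> partial iu (component T j') (axis_proj p) = 0.
  move=> j'u; apply: (partial_along_axis J _ 0) => // t Jt.
  by rewrite /component Taxis// axisE (negbTE j'u).
case: (indexP j) => [->|->|[l ->]].
- rewrite (partial_penrose_map_u U J)//; case: (indexP i) => [->|->|[k ->]];
    rewrite /dilation_weight !ixE/= ?mulr1n ?mulr0n ?mul1r ?mul0r.
  + under eq_fun do rewrite invr1 mul1r.
    exact: c0.
  + under eq_fun do rewrite divr1.
    exact: cvg_mul0 (cvg_expr0 2%N isT) (c0 _ _).
  + under eq_fun do rewrite divr1.
    exact: cvg_mul0 (cvg_expr0 1%N isT) (c0 _ _).
- rewrite (partial_penrose_map_v U J)//; case: (indexP i) => [->|->|[k ->]];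
    rewrite /dilation_weight !ixE/= ?mulr1n ?mulr0n ?mul1r ?mul0r ?add0r.
  + rewrite big1 ?addr0; last by move=> k _; rewrite ?ixE ?mulr0n mul0r.
    under eq_fun do rewrite mul1r.
    apply: (taylor2 U) => //; [exact: smooth_partial|exact: Du|] => k.
    rewrite (partialC U)//; apply: (partial_along_axis J _ 0) => // t Jt.
    exact: Tnull.
  + rewrite big1 ?addr0; last by move=> k _; rewrite ?ixE ?mulr0n mul0r.
    apply: (cvg_mul_weight _ (fun=> 1)) => [e e0|];
      first by rewrite divff// expf_neq0.
    under eq_fun do rewrite mul1r.
    exact: c0.
  + under eq_bigr do rewrite ixx; rewrite sum_pick.
    apply: (cvg_mul_weight _ (fun e => e^-1)) => [e e0|]; first by field.
    apply: (taylor1 U) => //; first exact: smooth_partial.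
    exact: Tnull.
- rewrite (partial_penrose_map_x U J)//; case: (indexP i) => [->|->|[k ->]];
    rewrite /dilation_weight !ixE/= ?mulr1n ?mulr0n ?mul1r ?mul0r ?add0r.
  + rewrite big1 ?addr0; last by move=> k _; rewrite ?ixE ?mulr0n mul0r.
    under eq_fun do rewrite mul1r.
    apply: (taylor1 U) => //; [exact: smooth_partial|exact: Du].
  + rewrite big1; last by move=> k _; rewrite ?ixE ?mulr0n mul0r.
    apply: (cvg_mul_weight _ (fun e => e ^+ 1)) => [e e0|]; first by field.
    exact: cvg_mul0 (cvg_expr0 1%N isT) (c0 _ _).
  + under eq_bigr do rewrite ixx; rewrite sum_pick.
    apply: (cvg_mul_weight _ (fun=> 1)) => [e e0|]; first by rewrite divff.
    under eq_fun do rewrite mul1r.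
    exact: c0.
Qed.

End RescaledJacobian.

(** The points r e stand both for Phi_e p and for its image by T. *)
Lemma cvg_rescaled_adapted U G (r : R -> 'rV[R]_n.+2) p i j :
  open U -> (forall q, U q -> adapted_form (G q) /\ (G q)^T = G q) ->
  U (axis_proj p) -> {for axis_proj p, continuous G} ->
  r e @[e --> 0^'+] --> axis_proj p ->
  e ^- 2 * dilation_weight e i * dilation_weight e j * G (r e) i j
    @[e --> 0^'+] --> rosen_mx G p i j.
Proof.
move=> oU aG Up cG rp.
have nU : \forall e \near (0 : R)^'+, U (r e).
  by apply: rp; exact: open_nbhs_nbhs.
have cGij i' j' : G (r e) i' j' @[e --> 0^'+] --> G (axis_proj p) i' j'.
  have cG' : G x @[x --> axis_proj p] --> G (axis_proj p) := cG.
  have H := cvg_comp r G rp cG'.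
  exact: (cvg_comp _ (fun A : 'M[R]_n.+2 => A i' j') H
    (@coord_continuous _ _ _ i' j' _)).
have cst_entry (w : R -> R) i' j' (c l : R) :
    (forall e, e != 0 -> w e * c = l) ->
    (forall q, U q -> G q i' j' = c) ->
    w e * G (r e) i' j' @[e --> 0^'+] --> l.
  move=> wc Gc; apply: cvg_near_cst; near=> e.
  rewrite Gc; last by near: e.
  by rewrite wc//; near: e; near=> e; apply: lt0r_neq0.
have row_u j' q : U q -> G q iu j' = (j' == iv)%:R.
  by move=> /aG[[a0 a1 a2] _]; case: (indexP j') => [->|->|[k ->]].
have col_u i' q : U q -> G q i' iu = (i' == iv)%:R.
  by move=> Uq; have [_ sG] := aG q Uq; rewrite -sG mxE row_u.
rewrite mxE; case: (indexP i) => [->|->|[k ->]];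
  case: (indexP j) => [->|->|[l ->]];
  rewrite /dilation_weight !ixE/=.
- by apply: cst_entry (row_u iu) => e e0; rewrite mulr0.
- by apply: cst_entry (row_u iv) => e e0; rewrite eqxx !mulr1 mulVf// expf_neq0.
- by apply: cst_entry (row_u (ix l)) => e e0; rewrite mulr0.
- by apply: cst_entry (col_u iv) => e e0; rewrite eqxx !mulr1 mulVf// expf_neq0.
- apply: (cvg_mul_weight _ (fun e => e ^+ 2)) => [e e0|]; first by field.
  exact: cvg_mul0 (cvg_expr0 2%N isT) (cGij _ _).
- apply: (cvg_mul_weight _ (fun e => e ^+ 1)) => [e e0|]; first by field.
  exact: cvg_mul0 (cvg_expr0 1%N isT) (cGij _ _).
- by apply: cst_entry (col_u (ix k)) => e e0; rewrite mulr0.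
- apply: (cvg_mul_weight _ (fun e => e ^+ 1)) => [e e0|]; first by field.
  exact: cvg_mul0 (cvg_expr0 1%N isT) (cGij _ _).
- apply: (cvg_mul_weight _ (fun=> 1)) => [e e0|]; first by field.
  by under eq_fun do rewrite mul1r; exact: cGij.
Unshelve. all: by end_near. Qed.

End Limit.

(** * Conformality of the limit map *)

Section Conformal.
Context {R : realType} {n : nat}.
Implicit Types (p q : 'rV[R]_n.+2) (f s : 'rV[R]_n.+2 -> R) (u : R)
  (U W : set 'rV[R]_n.+2) (G : 'rV[R]_n.+2 -> 'M[R]_n.+2).

Lemma dilation_weight_neq0 (e : R) (i : 'I_n.+2) : e != 0 ->
  dilation_weight e i != 0.
Proof.
move=> e0; rewrite /dilation_weight; case: (i == iu); first exact: oner_neq0.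
by case: (i == iv) => //; exact: expf_neq0.
Qed.

Lemma pullbackE (T : 'rV[R]_n.+2 -> 'rV[R]_n.+2) G p i j : differentiable T p ->
  pullback T G p i j =
  \sum_l (\sum_k partial i (component T k) p * G (T p) k l) *
    partial j (component T l) p.
Proof.
move=> dT; rewrite /pullback mxE; apply: eq_bigr => l _.
rewrite [_^T _ _]mxE jacobianE// mxE; congr (_ * _).
by apply: eq_bigr => k _; rewrite jacobianE.
Qed.

Section OneWay.
Variables (U W1 W2 : set 'rV[R]_n.+2) (J : set R)
  (T : 'rV[R]_n.+2 -> 'rV[R]_n.+2).
Hypotheses (oU : open U) (oJ : open J) (JU : forall u, J u -> U (axis u)).
Hypothesis sT : smooth_on U T.
Hypothesis Taxis : forall u, J u -> T (axis u) = axis (T (axis u) 0 iu).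
Variables (s : 'rV[R]_n.+2 -> R) (G1 G2 : 'rV[R]_n.+2 -> 'M[R]_n.+2).
Hypotheses (oW1 : open W1) (oW2 : open W2).
Hypothesis UW1 : forall q, U q -> W1 q.
Hypothesis UW2 : forall q, U q -> W2 (T q).
Hypothesis aG1 : forall q, W1 q -> adapted_form (G1 q) /\ (G1 q)^T = G1 q.
Hypothesis aG2 : forall q, W2 q -> adapted_form (G2 q) /\ (G2 q)^T = G2 q.
Hypothesis G12 : forall q, U q -> s q *: G1 q = pullback T G2 q.

Let dT q : U q -> differentiable T q.
Proof. by move=> Uq; exact: (smooth_row_differentiable _ U). Qed.

(** The first row of s G1 = T^* G2 on the axis. The u-derivative of T is a
multiple of the u-direction there, and G2 pairs that direction with v only. *)
Lemma transition_row_u u i : J u ->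
  partial iu (component T iu) (axis u) * partial i (component T iv) (axis u) =
  s (axis u) * (i == iv)%:R.
Proof.
move=> Ju; have Uu := JU _ Ju.
have Du j' : j' != iu -> partial iu (component T j') (axis u) = 0.
  move=> j'u; apply: (partial_along_axis J _ 0) => // t Jt.
  by rewrite /component Taxis// axisE (negbTE j'u).
have := congr1 (fun A : 'M[R]_n.+2 => A iu i) (G12 _ Uu).
rewrite pullbackE; last exact: dT.
have [[a0 a1 a2] _] := aG1 _ (UW1 _ Uu).
have [[b0 b1 b2] _] := aG2 _ (UW2 _ Uu).
rewrite mxE sum_uvx.
have E l : \sum_k partial iu (component T k) (axis u) * G2 (T (axis u)) k l =
    partial iu (component T iu) (axis u) * G2 (T (axis u)) iu l.
  rewrite sum_uvx (Du iv)// mul0r addr0 big1 ?addr0// => k _.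
  by rewrite (Du (ix k))// mul0r.
rewrite !E b0 b1 mulr0 mul0r add0r mulr1 big1 ?addr0; last first.
  by move=> k _; rewrite E b2 mulr0 mul0r.
by move=> <-; congr (_ * _); case: (indexP i) => [->|->|[k ->]].
Qed.

Lemma transition_null u k : J u -> s (axis u) != 0 ->
  partial (ix k) (component T iv) (axis u) = 0.
Proof.
move=> Ju s0; have H := transition_row_u u iv Ju.
have h0 : partial iu (component T iu) (axis u) != 0.
  by apply: contra_neq s0 => E; rewrite -[s _]mulr1 -H E mul0r.
by apply: (mulfI h0); rewrite transition_row_u// mulr0 mulr0.
Qed.

(** With W = diag(1, e^2, e), the weights of Phi_e, and J the Jacobian of T at
Phi_e p, the pullback identity at Phi_e p reads
  e^-2 W (s G1) W = (W J W^-1) (e^-2 W G2 W) (W J W^-1)^T,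
and all the entries of both sides converge. *)
Lemma pullback_penrose_map p : J (p 0 iu) -> s (axis_proj p) != 0 ->
  (forall u, J u -> s (axis u) != 0) ->
  {for axis_proj p, continuous s} -> {for axis_proj p, continuous G1} ->
  {for T (axis_proj p), continuous G2} ->
  s (axis_proj p) *: rosen_mx G1 p = pullback (penrose_map T) (rosen_mx G2) p.
Proof.
move=> Jp s0 sN0 cs cG1 cG2; have Up : U (axis_proj p) := JU _ Jp.
have dF : differentiable (penrose_map T) p.
  apply: (smooth_row_differentiable _ (penrose_domain J)) => //.
    exact: penrose_domain_open.
  exact: smooth_penrose_map oU oJ JU _ sT.
have nU : \forall e \near (0 : R)^'+, U (dilation e p).
  by apply: cvg_dilation; exact: open_nbhs_nbhs.
have ne : \forall e \near (0 : R)^'+, e != 0 by near=> e; apply: lt0r_neq0.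
have ap : axis_proj (penrose_map T p) = T (axis_proj p).
  by rewrite /axis_proj penrose_mapE/= -Taxis.
apply/matrixP => i j; rewrite pullbackE// mxE.
have cJ i' j' := cvg_rescaled_jacobian U J T oU oJ JU sT Taxis
  (fun u k Ju => transition_null u k Ju (sN0 u Ju)) p i' j' Jp.
have cT : T (dilation e p) @[e --> 0^'+] --> axis_proj (penrose_map T p).
  rewrite ap; have cT' : T q @[q --> axis_proj p] --> T (axis_proj p).
    exact: smooth_continuous sT Up.
  exact: (cvg_comp (fun e => dilation e p) T (@cvg_dilation R n p) cT').
have cR := @cvg_rescaled_adapted R n W2 G2 (fun e => T (dilation e p))
  (penrose_map T p) _ _ oW2 aG2 _ _ cT.
rewrite ap in cR; have {}cR k l := cR k l (UW2 _ Up) cG2.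
have cL := @cvg_rescaled_adapted R n W1 G1 (fun e => dilation e p) p i j oW1 aG1
  (UW1 _ Up) cG1 (@cvg_dilation R n p).
have cLs : s (dilation e p) * (e ^- 2 * dilation_weight e i *
    dilation_weight e j * G1 (dilation e p) i j) @[e --> 0^'+] -->
    s (axis_proj p) * rosen_mx G1 p i j.
  by apply: cvgM; [exact: taylor0|exact: cL].
have cRs : \sum_l (\sum_k
     (dilation_weight e i / dilation_weight e k *
       partial i (component T k) (dilation e p)) *
     (e ^- 2 * dilation_weight e k * dilation_weight e l *
       G2 (T (dilation e p)) k l)) *
     (dilation_weight e j / dilation_weight e l *
       partial j (component T l) (dilation e p))
    @[e --> 0^'+] --> \sum_l (\sum_k partial i (component (penrose_map T) k) p *
      rosen_mx G2 (penrose_map T p) k l) *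
      partial j (component (penrose_map T) l) p.
  apply: cvg_bigsum => l; apply: cvgM; last exact: cJ.
  by apply: cvg_bigsum => k; apply: cvgM; [exact: cJ|exact: cR].
have HR := @Rhausdorff R.
rewrite -[LHS](cvg_lim HR cLs); apply: (cvg_lim HR).
apply: cvg_trans cRs; apply: near_eq_cvg; near=> e.
have Ue : U (dilation e p) by near: e.
have e0 : e != 0 by near: e.
have := congr1 (fun A : 'M[R]_n.+2 => A i j) (G12 _ Ue).
rewrite pullbackE; last exact: dT.
rewrite mxE => E; rewrite mulrCA E mulr_sumr; apply: eq_bigr => l _.
rewrite !mulr_suml mulr_sumr; apply: eq_bigr => k _.
have wk := dilation_weight_neq0 e k e0; have wl := dilation_weight_neq0 e l e0.
by field; rewrite e0 wk wl.
Unshelve. all: by end_near. Qed.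

End OneWay.

(** * The inverse of the limit map *)

Lemma transverse_diff_ext f p q :
  (forall j, j != iv -> p 0 j = q 0 j) ->
    transverse_diff f p = transverse_diff f q.
Proof.
move=> pq; rewrite /transverse_diff /axis_proj pq//.
by apply: eq_bigr => k _; rewrite pq.
Qed.

Lemma transverse_hess_ext f p q :
  (forall j, j != iv -> p 0 j = q 0 j) ->
    transverse_hess f p = transverse_hess f q.
Proof.
move=> pq; rewrite /transverse_hess; apply: eq_bigr => k _.
by rewrite (transverse_diff_ext _ p q pq) pq.
Qed.

Lemma penrose_map_ext (T : 'rV[R]_n.+2 -> 'rV[R]_n.+2) p q j :
  (forall j, j != iv -> p 0 j = q 0 j) -> j != iv ->
  penrose_map T p 0 j = penrose_map T q 0 j.
Proof.
move=> pq jv; rewrite !penrose_mapE (negbTE jv) /axis_proj pq//.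
by case: (j == iu) => //; exact: transverse_diff_ext.
Qed.

Lemma chain_inverse U (T T' : 'rV[R]_n.+2 -> 'rV[R]_n.+2) p i j :
  open U -> smooth_on U T -> U p -> differentiable (component T' j) (T p) ->
  (forall q, U q -> T' (T q) = q) ->
  \sum_k partial i (component T k) p * partial k (component T' j) (T p) =
    (i == j)%:R.
Proof.
move=> oU sT Up dT' T'K; have dT : derivable T p (delta_mx 0 i).
  exact: smooth_derivable sT Up.
have [_] := is_derive_chain _ _ _ _ dT' dT.
have -> : \sum_k 'D_(delta_mx 0 i) T p 0 k * partial k (component T' j) (T p) =
    \sum_k partial i (component T k) p * partial k (component T' j) (T p).
  by apply: eq_bigr => k _; rewrite derive_mx// mxE.
move=> <-; rewrite eq_sym; have [_ <-] := partial_coordinate i j p.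
apply: near_eq_derive; have := open_nbhs_nbhs (conj oU Up).
by apply: filterS => q /T'K E; rewrite /component/= E.
Qed.

(* [penrose_map T] is affine in v, so it is inverted by solving for v once the
   other coordinates are known. *)
Definition penrose_inv (T T' : 'rV[R]_n.+2 -> 'rV[R]_n.+2) q : 'rV[R]_n.+2 :=
  \row_j if j == iv then
    partial iv (component T' iv) (axis_proj q) *
    (q 0 iv - 2^-1 * transverse_hess (component T iv) (penrose_map T' q))
  else penrose_map T' q 0 j.

Lemma penrose_invE T T' q j : j != iv ->
  penrose_inv T T' q 0 j = penrose_map T' q 0 j.
Proof. by move=> jv; rewrite mxE (negbTE jv). Qed.

(** The hypotheses are almost symmetric in T and T'; the lemmas are used both
for a change of coordinates and for its inverse. *)
Section HalfInverse.
Variables (U U' : set 'rV[R]_n.+2) (J J' : set R)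
  (T T' : 'rV[R]_n.+2 -> 'rV[R]_n.+2).
Hypotheses (oU : open U) (oU' : open U') (oJ : open J) (oJ' : open J').
Hypotheses (JU : forall u, J u -> U (axis u)) (sT : smooth_on U T).
Hypotheses (sT' : smooth_on U' T').
Hypothesis TU : forall q, U q -> U' (T q) /\ T' (T q) = q.
Hypothesis Taxis : forall u, J u -> J' (T (axis u) 0 iu) /\
  T (axis u) = axis (T (axis u) 0 iu).
Hypothesis T'axis : forall u, J' u -> T' (axis u) = axis (T' (axis u) 0 iu).
Hypothesis T'null : forall u k, J' u ->
  partial (ix k) (component T' iv) (axis u) = 0.

Let dT' j q : U' q -> differentiable (component T' j) q.
Proof.
by move=> Uq; apply: (smooth_differentiable U') => //; exact: smooth_component.
Qed.

Let chain u i j : J u ->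
  \sum_k partial i (component T k) (axis u) *
    partial k (component T' j) (T (axis u))
   = (i == j)%:R.
Proof.
move=> Ju; have Uu := JU _ Ju.
apply: (chain_inverse U) => //; first by apply: dT'; exact: (TU _ Uu).1.
by move=> q /TU[].
Qed.

Let D'u u j : J u -> j != iu -> partial iu (component T' j) (T (axis u)) = 0.
Proof.
move=> Ju ju; have [J'u ->] := Taxis _ Ju.
apply: (partial_along_axis J' _ 0) => // t Jt.
by rewrite /component T'axis// axisE (negbTE ju).
Qed.

Let D'x u k : J u -> partial (ix k) (component T' iv) (T (axis u)) = 0.
Proof. by move=> Ju; have [J'u ->] := Taxis _ Ju; exact: T'null. Qed.

Lemma chain_v u i : J u ->
  partial i (component T iv) (axis u) *
    partial iv (component T' iv) (T (axis u))
  = (i == iv)%:R.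
Proof.
move=> Ju; rewrite -(chain u i iv Ju) sum_uvx D'u// mulr0 add0r.
rewrite big1 ?addr0// => k _.
by rewrite D'x// mulr0.
Qed.

(** V_x = 0 on the axis passes from T' to T, by the chain rule. *)
Lemma inverse_null u k : J u -> partial (ix k) (component T iv) (axis u) = 0.
Proof.
move=> Ju; have := chain_v u iv Ju; rewrite eqxx => /eqP H.
have a0 : partial iv (component T' iv) (T (axis u)) != 0.
  by apply: contraTneq H => ->; rewrite mulr0 eq_sym oner_eq0.
by apply: (mulIf a0); rewrite chain_v// mul0r.
Qed.

Lemma chain_x u k l : J u ->
  \sum_m partial (ix k) (component T (ix m)) (axis u) *
    partial (ix m) (component T' (ix l)) (T (axis u)) = (k == l)%:R.
Proof.
move=> Ju; rewrite -[k == l]/(ix k == ix l) -(chain u (ix k) (ix l) Ju) sum_uvx.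
rewrite D'u//.
by rewrite inverse_null// mulr0 mul0r !add0r.
Qed.

Lemma axis_proj_penrose_map p : J (p 0 iu) ->
  axis_proj (penrose_map T p) = T (axis_proj p).
Proof.
by move=> Jp; rewrite /axis_proj penrose_mapE/=; have [_ <-] := Taxis _ Jp.
Qed.

(** The components other than v invert each other: the u-component by the
values of T on the axis, the x-component because its matrices are inverse
blocks of the Jacobians of T and T'. *)
Lemma penrose_mapK p j : J (p 0 iu) -> j != iv ->
  penrose_map T' (penrose_map T p) 0 j = p 0 j.
Proof.
move=> Jp jv; rewrite penrose_mapE (negbTE jv) axis_proj_penrose_map//.
case: (indexP j) jv => [->|->//|[l ->]] _ /=.
  by rewrite (TU _ (JU _ Jp)).2 /axis_proj axis_u.
rewrite /transverse_diff axis_proj_penrose_map//.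
under eq_bigr do rewrite penrose_mapE !ixE /transverse_diff mulr_suml.
rewrite exchange_big/=.
under eq_bigr do under eq_bigr do rewrite -mulrA.
under eq_bigr do rewrite -mulr_sumr chain_x// mulrC.
exact: sum_pick (fun k => p 0 (ix k)) l.
Qed.

Lemma penrose_map_domain p : J (p 0 iu) -> J' (penrose_map T p 0 iu).
Proof. by move=> Jp; rewrite penrose_mapE; exact: (Taxis _ Jp).1. Qed.

Lemma penrose_inv_domain p S : J (p 0 iu) -> J' (penrose_inv S T p 0 iu).
Proof. by move=> Jp; rewrite penrose_invE//; exact: penrose_map_domain. Qed.

Lemma penrose_inv_mapK p : J (p 0 iu) -> penrose_inv T T' (penrose_map T p) = p.
Proof.
move=> Jp; apply/rowP => j; have [->|jv] := eqVneq j iv; last first.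
  by rewrite penrose_invE// penrose_mapK.
rewrite mxE eqxx (transverse_hess_ext _ _ p); last first.
  by move=> k; exact: penrose_mapK.
rewrite penrose_mapE/= addrK axis_proj_penrose_map// mulrCA [X in _ * X]mulrC.
by rewrite chain_v// eqxx mulr1.
Qed.

Lemma penrose_map_invK p : J (p 0 iu) ->
  penrose_map T' (penrose_inv T' T p) = p.
Proof.
move=> Jp; apply/rowP => j; have [->|jv] := eqVneq j iv; last first.
  rewrite -[RHS](penrose_mapK p j Jp jv); apply: penrose_map_ext => // k.
  exact: penrose_invE.
have ap : axis_proj (penrose_inv T' T p) = T (axis_proj p).
  by rewrite -axis_proj_penrose_map// /axis_proj penrose_invE.
rewrite penrose_mapE/= ap (transverse_hess_ext _ _ (penrose_map T p));
  last first.
  by move=> k; exact: penrose_invE.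
rewrite mxE/= mulrAC chain_v// eqxx mul1r subrK.
by [].
Qed.

End HalfInverse.
End Conformal.

Lemma smooth_penrose_inv {R : realType} {n : nat} (U U' : set 'rV[R]_n.+2)
    (J J' : set R) (T T' : 'rV[R]_n.+2 -> 'rV[R]_n.+2) :
  open U -> open U' -> open J -> open J' ->
  (forall u, J u -> U (axis u)) -> (forall u, J' u -> U' (axis u)) ->
  smooth_on U T -> smooth_on U' T' ->
  (forall u, J' u -> J (T' (axis u) 0 iu)) ->
  smooth_on (penrose_domain J') (penrose_inv T T').
Proof.
move=> oU oU' oJ oJ' JU J'U' sT sT' T'J.
have oD := penrose_domain_open J oJ.
have oD' := @penrose_domain_open R n J' oJ'.
have sF' := smooth_penrose_map U' J' oU' oJ' J'U' T' sT'.
have sV' := smooth_component _ U' T' iv oU' sT'.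
apply: smooth_row => // j; under eq_fun do rewrite mxE.
case: (j == iv); last exact: smooth_component.
apply: (smoothM _ (fun q => partial iv (component T' iv) (axis_proj q))) => //.
  by apply: (smooth_axis_proj U') => //; exact: smooth_partial.
apply: (smoothD _ (fun q => q 0 iv) (fun q => - (2^-1 * transverse_hess
  (component T iv) (penrose_map T' q)))) => //; first exact: smooth_coordinate.
under eq_fun do rewrite -mulNr.
apply: (smoothM _ (fun=> - 2^-1)) => //; first exact: smooth_cst.
apply: (smooth_comp _ (penrose_domain J) _ _ (penrose_map T')) => //.
  by move=> q D'q; rewrite /penrose_domain/= penrose_mapE; exact: T'J.
by apply: (smooth_transverse_hess U) => //; exact: smooth_component.
Qed.

(** * Changes of coordinates *)

Section Charts.
Context {R : realType} {m : nat} {M : topologicalType}.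
Implicit Types phi psi : chart R m M.

Lemma chart_invK phi p : chart_codom phi p ->
  chart_dom phi (chart_inv phi p) /\ chart_map phi (chart_inv phi p) = p.
Proof. by move=> [x px <-]; rewrite chart_mapK. Qed.

Lemma overlapP phi psi p :
  overlap phi psi p <-> chart_codom phi p /\ chart_dom psi (chart_inv phi p).
Proof.
split=> [[x [px qx] <-]|[/chart_invK[px pE] qx]].
  by rewrite chart_mapK//; split=> //; exists x.
by exists (chart_inv phi p).
Qed.

Lemma overlap_open phi psi : open (overlap phi psi).
Proof.
rewrite openE => p /overlapP[cp dp].
have n1 : nbhs p (chart_codom phi).
  by apply: open_nbhs_nbhs; split=> //; exact: chart_codom_open.
have n2 : nbhs p (chart_inv phi @^-1` chart_dom psi).
  apply: chart_inv_continuous => //; apply: open_nbhs_nbhs.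
  by split=> //; exact: chart_dom_open.
by rewrite /interior; apply: filterS2 n1 n2 => q cq dq; apply/overlapP.
Qed.

Lemma transition_overlap phi psi p : overlap phi psi p ->
  overlap psi phi (transition phi psi p) /\
  transition psi phi (transition phi psi p) = p.
Proof.
move=> /overlapP[cp dp]; have [dp' pE] := chart_invK phi p cp.
rewrite /transition/= chart_mapK// pE; split=> //.
apply/overlapP; rewrite chart_mapK//; split=> //.
by exists (chart_inv phi p).
Qed.

Lemma chart_inv_transition phi psi p : overlap phi psi p ->
  chart_inv psi (transition phi psi p) = chart_inv phi p.
Proof. by move=> /overlapP[cp dp]; rewrite /transition/= chart_mapK. Qed.

Lemma transition_codom phi psi p : overlap phi psi p ->
  chart_codom psi (transition phi psi p).
Proof. by move=> /transition_overlap[/overlapP[]]. Qed.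

End Charts.

(** Adapted charts put corresponding points of the two curves on the axis. *)
Lemma adapted_transition {R : realType} {n : nat} (M : manifold R n.+2)
    (J J' : set R) (gamma gamma' : R -> M) (phi phi' : chart R n.+2 M)
    (u u' : R) :
  (chart_dom phi (gamma u) /\ chart_map phi (gamma u) = axis u) ->
  (chart_dom phi' (gamma' u') /\ chart_map phi' (gamma' u') = axis u') ->
  gamma u = gamma' u' ->
  overlap phi phi' (axis u) /\ transition phi phi' (axis u) = axis u'.
Proof.
move=> [d E] [d' E'] gg.
have iE : chart_inv phi (axis u) = gamma u by rewrite -E chart_mapK.
split; last by rewrite /transition/= iE gg.
by apply/overlapP; rewrite iE gg; split=> //; exists (gamma u).
Qed.

Lemma conformal_factor_continuous {R : realType} {m : nat} (M : manifold R m)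
    (sigma : M -> R) (phi : chart R m M) (p : 'rV[R]_m) :
  smooth_function sigma -> atlas phi -> chart_codom phi p ->
  {for p, continuous (fun q => expR (sigma (chart_inv phi q)))}.
Proof.
move=> ss aphi cp; have H := smooth_continuous _ _ _ (ss phi aphi) cp.
apply: (@continuous_comp _ _ _ (sigma \o chart_inv phi) expR) => //.
exact: continuous_expR.
Qed.

Theorem proposition7p1 (R : realType) (n : nat) (M : manifold R n.+2)
    (g : metric_family M) (hg : lorentzian_metric g)
    (sigma : M -> R) (hsigma : smooth_function sigma)
    (* the null geodesic gamma of g, and the piece of it over J *)
    (I J : set R) (gamma : R -> M)
    (hI : open_interval I) (hgamma : null_geodesic g I gamma)
    (hJ : open_interval J) (hJI : J `<=` I)
    (* the same piece, affinely reparametrized for g_sigma *)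
    (J' : set R) (gamma' : R -> M) (hJ' : open_interval J')
    (hrep : reparametrization J gamma J' gamma')
    (hgamma' : null_geodesic (conformal_change sigma g) J' gamma')
    (* adapted coordinates for g and for g_sigma *)
    (phi phi' : chart R n.+2 M)
    (hphi : adapted_chart g J gamma phi)
    (hphi' : adapted_chart (conformal_change sigma g) J' gamma' phi') :
  exists F : 'rV[R]_n.+2 -> 'rV[R]_n.+2,
    conformal_diffeomorphism
      (penrose_domain J) (penrose_limit (g phi))
      (penrose_domain J') (penrose_limit (conformal_change sigma g phi')) F.
Proof.
have [sg sym_g change_g] := hg.
have [aphi phi_gamma adapted_phi] := hphi.
have [aphi' phi'_gamma' adapted_phi'] := hphi'.
have [oJ _ _] := hJ; have [oJ' _ _] := hJ'.
have [h [_ _ hJJ' gamma_h]] := hrep.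
set G1 := g phi; set G2 := conformal_change sigma g phi'.
set T := transition phi phi'; set T' := transition phi' phi.
set U := overlap phi phi'; set U' := overlap phi' phi.
have oU : open U := overlap_open phi phi'.
have oU' : open U' := overlap_open phi' phi.
have [sT sT'] : smooth_on U T /\ smooth_on U' T'.
  exact: (atlas_compatible aphi aphi').
have J'h u : J u -> J' (h u) by rewrite -hJJ' => Ju; exists u.
have TJ u : J u -> U (axis u) /\ T (axis u) = axis (h u).
  move=> Ju; apply: (adapted_transition _ J J' gamma gamma').
  - exact: phi_gamma.
  - exact/phi'_gamma'/J'h.
  - by rewrite gamma_h.
have T'J' u' : J' u' -> exists2 u, J u & U' (axis u') /\ T' (axis u') = axis u.
  rewrite -hJJ' => -[u Ju <-]; exists u => //.
  apply: (adapted_transition _ J' J gamma' gamma).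
  - exact/phi'_gamma'/J'h.
  - exact: phi_gamma.
  - by rewrite gamma_h.
have JU u : J u -> U (axis u) by move=> /TJ[].
have J'U' u : J' u -> U' (axis u) by move=> /T'J'[? _ []].
have Taxis u : J u ->
    J' (T (axis u) 0 iu) /\ T (axis u) = axis (T (axis u) 0 iu).
  by move=> Ju; have [_ ->] := TJ u Ju; rewrite axis_u; split=> //; exact: J'h.
have T'axis u : J' u ->
    J (T' (axis u) 0 iu) /\ T' (axis u) = axis (T' (axis u) 0 iu).
  by move=> /T'J'[u' Ju' [_ ->]]; rewrite axis_u.
have TU q : U q -> U' (T q) /\ T' (T q) = q by exact: transition_overlap.
have T'U' q : U' q -> U (T' q) /\ T (T' q) = q by exact: transition_overlap.
pose s q := expR (sigma (chart_inv phi q)).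
have s_gt0 q : 0 < s q by exact: expR_gt0.
have s_neq0 q : s q != 0 by exact: lt0r_neq0.
have aG1 q : chart_codom phi q -> adapted_form (G1 q) /\ (G1 q)^T = G1 q.
  by move=> cq; split; [exact: adapted_phi|have [] := sym_g _ _ aphi cq].
have aG2 q : chart_codom phi' q -> adapted_form (G2 q) /\ (G2 q)^T = G2 q.
  move=> cq; split; first exact: adapted_phi'.
  by rewrite /G2 /conformal_change linearZ/=; have [-> _] := sym_g _ _ aphi' cq.
have G12 q : U q -> s q *: G1 q = pullback T G2 q.
  move=> Uq; rewrite /G1 (change_g _ _ _ aphi aphi' Uq) /pullback /G2
    /conformal_change.
  by rewrite chart_inv_transition// -scalemxAr -scalemxAl.
have UW1 q : U q -> chart_codom phi q by move=> /overlapP[].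
have UW2 q : U q -> chart_codom phi' (T q) by exact: transition_codom.
have oW1 : open (chart_codom phi) := @chart_codom_open _ _ _ phi.
have oW2 : open (chart_codom phi') := @chart_codom_open _ _ _ phi'.
have Tax u (Ju : J u) := (Taxis u Ju).2.
have T'ax u (Ju : J' u) := (T'axis u Ju).2.
have Tnull u k : J u -> partial (ix k) (component T iv) (axis u) = 0.
  move=> Ju; apply: (transition_null U _ _ J T oU oJ JU sT Tax s G1 G2 UW1 UW2
    aG1 aG2 G12) => //.
have T'null u k : J' u -> partial (ix k) (component T' iv) (axis u) = 0.
  exact: (inverse_null U' U J' J T' T).
have cG1 q : chart_codom phi q -> {for q, continuous G1}.
  by move=> cq; exact: smooth_continuous (sg _ aphi) cq.
have cG2 q : chart_codom phi' q -> {for q, continuous G2}.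
  move=> cq; have cs := conformal_factor_continuous M sigma phi' q hsigma aphi'
    cq.
  have cg := smooth_continuous _ _ _ (sg _ aphi') cq.
  exact: (continuousZ cs cg).
exists (penrose_map T); split.
  exists (penrose_inv T T'); split.
  - exact: (smooth_penrose_map U J oU oJ JU T sT).
  - apply: (smooth_penrose_inv U U' J J') => // u J'u.
    exact: (T'axis u J'u).1.
  - move=> p Jp; split; first exact: (penrose_map_domain J J').
    exact: (penrose_inv_mapK U U' J J').
  - move=> q Jq; split; first exact: (penrose_inv_domain J' J).
    exact: (penrose_map_invK U' U J' J).
exists (fun p => partial iu (component T iu) (axis_proj p) *
  partial iv (component T iv) (axis_proj p)); split.
  have sTj j : smooth_on U (component T j) by exact: smooth_component.
  have oD := @penrose_domain_open R n J oJ.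
  by apply: smoothM => //; apply: (smooth_axis_proj U) => //;
    exact: smooth_partial.
move=> p Jp; have Up : U (axis_proj p) by exact: JU.
rewrite (transition_row_u U _ _ J T oU oJ JU sT Tax s G1 G2 UW1 UW2 aG1 aG2
  G12)//.
rewrite eqxx mulr1; split; first exact: s_gt0.
have -> : penrose_limit G1 p = rosen_mx G1 p.
  by apply: (penrose_limitE oW1 aG1); [exact: UW1|apply: cG1; exact: UW1].
have Wp := UW1 _ Up; have W'p := UW2 _ Up.
have cs := conformal_factor_continuous M sigma phi _ hsigma aphi Wp.
apply: etrans (esym (pullback_penrose_map U _ _ J T oU oJ JU sT Tax s G1 G2
  oW1 oW2 UW1 UW2 aG1 aG2 G12 p Jp (s_neq0 _) (fun u _ => s_neq0 _)
  cs (cG1 _ Wp) (cG2 _ W'p))).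
rewrite /pullback; congr (_ *m _ *m _).
have ap : axis (penrose_map T p 0 iu) = T (axis_proj p).
  exact: (axis_proj_penrose_map J J' T Taxis).
by apply: (penrose_limitE oW2 aG2); rewrite ap; [exact: W'p|exact: cG2].
Qed.
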